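(* Let $\gamma>0$, let $\mathbf U_0\in D(A)$, and let $\mathbf U(t)$ be a classical solution of the damped problem $$\partial_t\mathbf U(t)=A\,\mathbf U(t)-\gamma\,\mathbf U(t),\quad t>0,\qquad \mathbf U(0)=\mathbf U_0\in D(A).$$ Then the energy $E(t)=\tfrac12\|\mathbf U(t)\|_{L^2(\mathcal G)}^2$ satisfies $E(t)\le e^{-2\gamma t}E(0)$ for all $t\ge0$, or equivalently $\|\mathbf U(t)\|_{L^2(\mathcal G)}\le e^{-\gamma t}\|\mathbf U_0\|_{L^2(\mathcal G)}$ for all $t\ge0$. In particular, the solution decays to zero exponentially at rate $\gamma$, independently of the dispersive coefficients $\alpha$ and $\beta$.
   Context: Let $L>0$, $\alpha>0$, $\beta\in\mathbb R$. The tadpole graph $\mathcal G$ has edges $[-L,L]$ and $[L,\infty)$; functions on $\mathcal G$ are pairs $\mathbf U=(\phi,\psi)$ with $\phi$ on $[-L,L]$ and $\psi$ on $[L,\infty)$. $L^2(\mathcal G)=L^2(-L,L)\oplus L^2(L,\infty)$ and $H^3(\mathcal G)=H^3(-L,L)\oplus H^3(L,\infty)$. The operator $A$ acts as $A\mathbf U=(\alpha\phi'''+\beta\phi',\ \alpha\psi'''+\beta\psi')$ with domain $$D(A)=\{(\phi,\psi)\in H^3(\mathcal G):\ \phi(-L)=\phi(L),\ \phi'(-L)=\phi'(L),\ \phi''(-L)=\phi''(L),\ \psi(L)=0,\ \psi'(L)=0\}.$$ A classical solution is a function $\mathbf U\in C^1([0,\infty);L^2(\mathcal G))\cap C([0,\infty);D(A))$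 satisfying the equation. *)

(* Defs.v *)
From HB Require Import structures.
From mathcomp Require Import all_boot all_order all_algebra.
From mathcomp Require Import all_classical all_reals all_analysis.
From mathcomp Require Export complex.

Set Implicit Arguments.
Unset Strict Implicit.
Unset Printing Implicit Defensive.

Import Order.TTheory GRing.Theory Num.Theory.
Import numFieldNormedType.Exports.

Local Open Scope classical_set_scope.
Local Open Scope ring_scope.
Local Open Scope complex_scope.

(* The function spaces are complex: the real case is the
   one of functions with zero imaginary part.  An element of L^2(I), for an
   open interval I, is represented by a function R -> R[i] of which only the
   almost everywhere class on I matters. *)

Section Edge.
Context {R : realType}.
Notation mu := (@lebesgue_measure R).
Implicit Types (I : set R) (f g : R -> R[i]) (w : R -> R).

Definition L2 I f : Prop :=
  (fun x => complex.Re (f x)) \_ I \in Lfun mu 2%:E /\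
  (fun x => complex.Im (f x)) \_ I \in Lfun mu 2%:E.

Definition L2normsq I f : R := \int[mu]_(x in I) (Normc.normc (f x) ^+ 2).

Definition cintegral I f : R[i] :=
  (\int[mu]_(x in I) complex.Re (f x)) +i* (\int[mu]_(x in I) complex.Im (f x)).

(* C^1 functions with compact support in the open interval I *)
Definition test_function I w : Prop :=
  [/\ forall x, derivable w x 1,
      continuous (derive1 w) &
      exists a b : R, `[a, b] `<=` I /\
        (forall x, x \notin `[a, b] -> w x = 0)].

(* The Sobolev spaces H^m(I) and their weak derivatives are those of Brezis,
   Functional Analysis, Sobolev Spaces and PDE, Chapter 8, where the test
   functions on an interval are C^1. *)
Definition is_weak_derivative I f g : Prop :=
  forall w, test_function I w ->
    cintegral I (fun x => f x * (derive1 w x)%:C) =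
    - cintegral I (fun x => g x * (w x)%:C).

Fixpoint sobolev (m : nat) I f : Prop :=
  if m is m'.+1 then
    L2 I f /\ exists g, is_weak_derivative I f g /\ sobolev m' I g
  else L2 I f.

(* A representative of the weak derivative of f in H^1(I), which is unique
   almost everywhere on I (junk value 0 when f is not in H^1(I)) *)
Definition wderiv I f : R -> R[i] :=
  xget (fun=> 0) [set g | L2 I g /\ is_weak_derivative I f g].

Definition wderivn (k : nat) I f : R -> R[i] := iter k (wderiv I) f.

(* The representative of f in H^1(I) that is continuous on the closure of I,
   by which f is evaluated at the end points of I *)
Definition continuous_rep I f : R -> R[i] :=
  xget (fun=> 0) [set g |
    [/\ {within closure I, continuous (fun x => complex.Re (g x))},
        {within closure I, continuous (fun x => complex.Im (g x))} &
        f = g %[ae mu in I]]].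

Definition boundary_value I f (a : R) : R[i] := continuous_rep I f a.

End Edge.

Section Tadpole.
Context {R : realType}.
Notation mu := (@lebesgue_measure R).

(* a pair (phi, psi) of functions on the loop and on the half-line *)
Definition graph_fun : Type := ((R -> R[i]) * (R -> R[i]))%type.

Implicit Types (L alpha beta gamma : R) (V W : graph_fun) (U : R -> graph_fun).

Definition loop L : set R := `]- L, L[%classic.
Definition half_line L : set R := `]L, +oo[%classic.

Definition graph_L2 L V : Prop := L2 (loop L) V.1 /\ L2 (half_line L) V.2.

(* equality in L^2(G) *)
Definition graph_eq L V W : Prop :=
  V.1 = W.1 %[ae mu in loop L] /\ V.2 = W.2 %[ae mu in half_line L].

Definition graph_norm L V : R :=
  Num.sqrt (L2normsq (loop L) V.1 + L2normsq (half_line L) V.2).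

Definition graph_lin (c d : R) V W : graph_fun :=
  (fun x => c%:C * V.1 x + d%:C * W.1 x, fun x => c%:C * V.2 x + d%:C * W.2 x).

Definition graph_sub V W : graph_fun := graph_lin 1 (-1) V W.

Definition A_op L alpha beta V : graph_fun :=
  graph_lin alpha beta
    (wderivn 3 (loop L) V.1, wderivn 3 (half_line L) V.2)
    (wderivn 1 (loop L) V.1, wderivn 1 (half_line L) V.2).

Definition A_dom L V : Prop :=
  [/\ sobolev 3 (loop L) V.1,
      sobolev 3 (half_line L) V.2,
      forall k, (k < 3)%N ->
        boundary_value (loop L) (wderivn k (loop L) V.1) (- L) =
        boundary_value (loop L) (wderivn k (loop L) V.1) L &
      forall k, (k < 2)%N ->
        boundary_value (half_line L) (wderivn k (half_line L) V.2) L = 0].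

(* the norm of the graph of A, which gives D(A) its topology *)
Definition A_norm L alpha beta V : R :=
  graph_norm L V + graph_norm L (A_op L alpha beta V).

(* continuity on [0, oo) for the norm N, one-sided at 0 *)
Definition continuous_in (N : graph_fun -> R) U : Prop :=
  forall t, 0 <= t ->
    N (graph_sub (U s) (U t))
      @[s --> within `[0, +oo[%classic (nbhs t)] --> (0 : R).

(* U' is the derivative of U on [0, oo) in L^2(G), one-sided at 0 *)
Definition L2_derivative L U (U' : R -> graph_fun) : Prop :=
  forall t, 0 <= t ->
    graph_norm L
      (graph_sub (graph_lin (s - t)^-1 (- (s - t)^-1) (U s) (U t)) (U' t))
      @[s --> within `[0, +oo[%classic (t^')] --> (0 : R).

Definition classical_solution L alpha beta gamma (U0 : graph_fun) U : Prop :=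
  [/\ forall t, 0 <= t -> A_dom L (U t),
      continuous_in (A_norm L alpha beta) U,
      exists U' : R -> graph_fun,
        [/\ forall t, 0 <= t -> graph_L2 L (U' t),
            L2_derivative L U U',
            continuous_in (graph_norm L) U' &
            forall t, 0 < t ->
              graph_eq L (U' t)
                (graph_lin 1 (- gamma) (A_op L alpha beta (U t)) (U t))] &
      graph_eq L (U 0) U0].

Definition energy L V : R := 2^-1 * graph_norm L V ^+ 2.

End Tadpole.

Arguments graph_fun : clear implicits.

(* Main.v *)
(** The generator A is skew in L^2(G): integrating by parts on each edge,
    Re <A V, V> is a difference of boundary values of
    alpha (v'' v - v'^2 / 2) + beta v^2 / 2, for v the real and the imaginary
    part of each component of V.  On the loop these cancel by periodicity.
    On the half-line they vanish at L by the boundary conditions, and at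
    infinity because the expression is integrable and has a limit there.
    Hence N(t) = |U(t)|^2 satisfies N' = -2 gamma N for t > 0, and
    exp(2 gamma t) N(t) is nonincreasing on [0, oo).

    The integration by parts needs the theory of H^1 on an interval.  If G is
    a weak derivative of F, testing it against smoothed indicators of [p, q]
    gives F(q) - F(p) = \int_p^q G for all Lebesgue points p <= q of F and G,
    so that F is a.e. equal to a primitive of G.  The product rule for
    primitives of integrable functions is Fubini's theorem. *)
Require Import Defs.
From mathcomp Require Import all_boot all_order all_algebra.
From mathcomp Require Import all_classical all_reals all_analysis.
From mathcomp Require Import measurable_realfun ring lra.
Import Order.TTheory GRing.Theory Num.Theory.
Import numFieldNormedType.Exports.
Local Open Scope classical_set_scope.
Local Open Scope ring_scope.

Set Implicit Arguments.
Unset Strict Implicit.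
Unset Printing Implicit Defensive.

(** * A C^1 step function *)

Section SmoothStep.
Context {R : realType}.
Implicit Types (h x y : R).

(** [wderiv] and [continuous_rep] only choose some function with the required property, so their
    values carry information through uniqueness alone: almost everywhere for weak derivatives, on
    the closure of the edge for continuous representatives. Each edge is therefore reduced to
    explicit primitives [U0], [U1], [U2] of the weak derivatives, and the boundary conditions become
    equations between values of these primitives. Both edges have a finite left end a, and an L^2
    function extended by zero is locally integrable on the line, so a single argument with
    primitives based at a serves both. Since test functions need only be C^1, quadratic splines are
    smooth enough to play the smoothed indicators. In time, the equation is available for t > 0
    only: the differential identity is used inside ]0, T[, and continuity in the graph norm carries
    the estimate down to t = 0. *)

Definition sqpos y : R := Num.max y 0 ^+ 2.

(** The slope 2 max(y, 0) of [sqpos] is 2-Lipschitz, which bounds the first-order Taylor remainder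
    by h^2; the four sign cases are polynomial inequalities. *)
Lemma sqpos_taylor x h :
  `|sqpos (x + h) - sqpos x - h * (2 * Num.max x 0)| <= h ^+ 2.
Proof.
rewrite /sqpos ler_norml; case: (leP x 0) => hx; case: (leP (x + h) 0) => hxh;
  nra.
Qed.

Lemma is_derive_sqpos x : is_derive x (1 : R) sqpos (2 * Num.max x 0).
Proof.
suff H : (fun h : R => h^-1 *: ((sqpos \o shift x) (h *: 1) - sqpos x)) @ 0^'
    --> 2 * Num.max x 0.
  apply: DeriveDef; first by apply/cvg_ex; exists (2 * Num.max x 0).
  exact: cvg_lim.
apply/cvgrPdist_le => /= e e0; near=> h.
have hn0 : h != 0 by near: h; exact: nbhs_dnbhs_neq.
have he : `|h| <= e.
  by near: h; apply: dnbhs0_le.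
rewrite (_ : _ - _ = - (h^-1 * (sqpos (x + h) - sqpos x - h * (2 * Num.max x 0)))); last first.
  by rewrite /GRing.scale/= mulr1 [h + x]addrC; field.
rewrite normrN normrM normfV ler_pdivrMl ?normr_gt0// (le_trans (sqpos_taylor x h))//.
by rewrite -normr_id -real_normK ?num_real// expr2 normr_id ler_wpM2l.
Unshelve. all: by end_near. Qed.

(* [tent h] and its primitive [step h] are second differences of max(y, 0)
   and of max(y, 0)^2; [step h] increases from 0 at -h to 1 at h. *)
Definition tent h y : R :=
  (Num.max (y + h) 0 - 2 * Num.max y 0 + Num.max (y - h) 0) / h ^+ 2.

Definition step h y : R :=
  (sqpos (y + h) - 2 * sqpos y + sqpos (y - h)) / (2 * h ^+ 2).

Lemma tent_ge0 h y : 0 < h -> 0 <= tent h y.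
Proof.
move=> h0; rewrite /tent divr_ge0 ?sqr_ge0//.
by case: (leP y 0) => ?; case: (leP (y + h) 0) => ?;
  case: (leP (y - h) 0) => ?; lra.
Qed.

Lemma tent_le h y : 0 < h -> tent h y <= h^-1.
Proof.
move=> h0; rewrite /tent ler_pdivrMr ?exprn_gt0// expr2 mulKf ?gt_eqF//.
by case: (leP y 0) => ?; case: (leP (y + h) 0) => ?;
  case: (leP (y - h) 0) => ?; lra.
Qed.

Lemma tent_eq0 h y : 0 < h -> h <= `|y| -> tent h y = 0.
Proof.
move=> h0 hy; rewrite /tent; set n := (X in X / _); suff -> : n = 0 by rewrite mul0r.
rewrite /n; move: hy; rewrite ler_normr => /orP[] hy.
  by rewrite !max_l//; lra.
by rewrite !max_r//; lra.
Qed.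

Lemma step_le0 h y : 0 < h -> y <= - h -> step h y = 0.
Proof.
by move=> h0 hy; rewrite /step /sqpos !max_r ?expr0n ?mulr0 ?subr0 ?addr0 ?mul0r//; lra.
Qed.

Lemma step_ge1 h y : 0 < h -> h <= y -> step h y = 1.
Proof.
move=> h0 hy; rewrite /step /sqpos !max_l; [|lra..].
have hn : h != 0 by rewrite gt_eqF.
by field.
Qed.

Lemma step_bound h y : 0 < h -> 0 <= step h y <= 1.
Proof.
move=> h0; rewrite /step /sqpos; apply/andP; split.
  apply: divr_ge0; last by rewrite mulr_ge0// sqr_ge0.
  by case: (leP y 0) => ?; case: (leP (y + h) 0) => ?;
    case: (leP (y - h) 0) => ?; nra.
rewrite ler_pdivrMr ?mulr_gt0 ?exprn_gt0// mul1r.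
by case: (leP y 0) => ?; case: (leP (y + h) 0) => ?;
    case: (leP (y - h) 0) => ?; nra.
Qed.

Lemma is_derive_step h p x : 0 < h ->
  is_derive x (1 : R) (fun y => step h (y - p)) (tent h (x - p)).
Proof.
move=> h0.
have D c : is_derive x (1 : R) (fun y => sqpos (y - p + c)) (2 * Num.max (x - p + c) 0).
  have := @is_derive_sqpos (x - p + c) => H.
  have H2 : is_derive x (1 : R) (fun y => y - p + c) 1.
    by apply: is_derive_eq; rewrite subr0 addr0.
  have := @is_derive1_comp R sqpos (fun y => y - p + c) x _ _ H H2.
  by rewrite mulr1.
have D0 : is_derive x (1 : R) (fun y => sqpos (y - p)) (2 * Num.max (x - p) 0).
  by have := D 0; rewrite addr0; under eq_fun do rewrite addr0.
have D1 := D h. have D2 := D (- h).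
rewrite /step.
apply: is_derive_eq.
rewrite /tent /GRing.scale/=.
have hn : h != 0 by rewrite gt_eqF.
by field.
Qed.

Lemma continuous_tent h p : continuous (fun y => tent h (y - p)).
Proof.
move=> x; rewrite /tent.
have C c : {for x, continuous (fun y => Num.max (y - p + c) 0)}.
  apply: (@continuous_max _ _ (fun y => y - p + c) (cst 0)).
    by apply: cvgD; [apply: cvgB; [exact: cvg_id|exact: cvg_cst]|exact: cvg_cst].
  exact: cvg_cst.
have C0 : {for x, continuous (fun y => Num.max (y - p) 0)}.
  have -> : (fun y => Num.max (y - p) 0) = (fun y => Num.max (y - p + 0) 0).
    by apply/funext => y; rewrite addr0.
  exact: C.
apply: cvgMl; apply: cvgD; [apply: cvgB|exact: C (- h)]; [exact: C|].
by apply: cvgMr.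
Qed.

End SmoothStep.

(** * Weak derivatives at Lebesgue points *)

Section RealIntegrable.
Context d (T : measurableType d) (R : realType) (mu : {measure set T -> \bar R}).
Implicit Types (f g : T -> R) (D : set T).

Lemma integrable_mulrl D f c : measurable D -> mu.-integrable D (EFin \o f) ->
  mu.-integrable D (EFin \o (fun x => c * f x)).
Proof. by move=> mD /(integrableZl mD c); apply: eq_integrable. Qed.

Lemma integrable_mulrr D f c : measurable D -> mu.-integrable D (EFin \o f) ->
  mu.-integrable D (EFin \o (fun x => f x * c)).
Proof. by move=> mD /(integrableZr mD c); apply: eq_integrable. Qed.

Lemma integrable_addr D f g : measurable D -> mu.-integrable D (EFin \o f) ->
  mu.-integrable D (EFin \o g) ->
  mu.-integrable D (EFin \o (fun x => f x + g x)).
Proof. by move=> mD fi gi; have := integrableD mD fi gi; apply: eq_integrable. Qed.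

Lemma integrable_subr D f g : measurable D -> mu.-integrable D (EFin \o f) ->
  mu.-integrable D (EFin \o g) ->
  mu.-integrable D (EFin \o (fun x => f x - g x)).
Proof. by move=> mD fi gi; have := integrableB mD fi gi; apply: eq_integrable. Qed.

Lemma Rintegral_supp D f : (forall x, ~ D x -> f x = 0) ->
  \int[mu]_x f x = \int[mu]_(x in D) f x.
Proof.
move=> fD; rewrite [RHS]Rintegral_mkcond; apply: eq_Rintegral => x _.
by rewrite patchE; case: ifPn => // /negP xD; apply: fD => /mem_set.
Qed.

Lemma integrable_supp D f : measurable D -> (forall x, ~ D x -> f x = 0) ->
  mu.-integrable D (EFin \o f) -> mu.-integrable setT (EFin \o f).
Proof.
move=> mD fD; rewrite (integrable_mkcond _ mD); apply: eq_integrable => // x _.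
by rewrite patchE; case: ifPn => // /negP xD; rewrite /= fD// => /mem_set.
Qed.

End RealIntegrable.

(** * Integrals against bounded kernels near a Lebesgue point *)

Section LebesguePoints.
Context {R : realType}.
Notation mu := (@lebesgue_measure R).
Implicit Types (f k : R -> R) (p r e : R).

Lemma locally_integrable_itv f (i : interval R) (a b : R) :
  [set` i] `<=` `[a, b] ->
  locally_integrable setT f -> mu.-integrable [set` i] (EFin \o f).
Proof.
move=> iab [mf _ foo]; apply: (@integrableS _ _ _ mu `[a, b]) => //.
apply/integrableP; split; first exact/measurable_EFinP/measurable_funTS.
by apply: foo => //; exact: segment_compact.
Qed.

Lemma locally_integrable_ball f p r :
  locally_integrable setT f -> mu.-integrable (ball p r) (EFin \o f).
Proof.
move=> fl; rewrite ball_itv.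
by apply: (@locally_integrable_itv _ _ (p - r) (p + r)) => //; exact: subset_itvW.
Qed.

Lemma locally_integrable_ballM f k p r M :
  locally_integrable setT f -> measurable_fun setT k ->
  (forall x, `|k x| <= M) -> mu.-integrable (ball p r) (EFin \o (f \* k)).
Proof.
move=> fl mk kM.
have -> : EFin \o (f \* k) = ((EFin \o k) \* (EFin \o f))%E.
  by apply/funext => x /=; rewrite mulrC EFinM.
apply: integrableMr => //; first exact: measurable_ball.
- exact: measurable_funTS.
- by exists M; split; rewrite ?num_real// => y My x _; exact: le_trans (kM x) (ltW My).
- exact: locally_integrable_ball.
Qed.

Lemma locally_integrable_cst (c : R) : locally_integrable setT (cst c : R -> R).
Proof.
split; [exact: measurable_cst|exact: openT|move=> K _ cK].
have := @integral_cst _ _ _ mu _ (compact_measurable cK) `|c|%:E.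
rewrite /cst => ->.
rewrite -ge0_fin_numE ?mule_ge0 ?lee_fin// fin_numM//.
by rewrite ge0_fin_numE//; exact: compact_finite_measure.
Qed.

Lemma lebesgue_pt_small f p e : locally_integrable setT f -> lebesgue_pt f p -> 0 < e ->
  \forall r \near (0 : R)^'+, \int[mu]_(y in ball p r) `|f y - f p| <= e * r.
Proof.
move=> fl fp e0.
(* The ball has measure 2 r, so a mean of at most e / 2 means an integral of at most e r. *)
have e20 : 0 < e / 2 by rewrite divr_gt0.
move/fine_cvgP : fp => [fin /cvgrPdist_le /= /(_ _ e20) H].
near=> r.
have r0 : 0 < r by near: r; exact: nbhs_right_gt.
have : `|0 - fine (davg f p r)| <= e / 2 by near: r.
rewrite sub0r normrN ger0_norm; last by rewrite fine_ge0// davg_ge0.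
rewrite /davg /iavg.
rewrite lebesgue_measure_ball ?(ltW r0)//.
rewrite inver mulrn_eq0/= gt_eqF// /Rintegral.
set J := (\int[_]_(_ in _) _)%E => JE.
have Jfin : J \is a fin_num.
  apply: (@integrable_fin_num _ _ _ mu) => //; first exact: measurable_ball.
  apply: (@integrable_norm _ _ _ mu _ (fun x => f x - f p)).
  apply: locally_integrable_ball.
  exact: (locally_integrableB fl (locally_integrable_cst (f p))).
move: JE; rewrite -(fineK Jfin) -EFinM/=.
by rewrite ler_pdivrMl ?mulrn_wgt0// => /le_trans; apply; rewrite -mulr_natr; lra.
Unshelve. all: by end_near. Qed.

(** The difference is the integral of (f - f p) k, at most r^-1 times the integral of |f - f p|,
    which is at most e r. The radius is chosen before the kernel, so the estimate applies to kernels
    that depend on r, such as [tent r]. *)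
Lemma lebesgue_pt_kernel f p e : locally_integrable setT f -> lebesgue_pt f p -> 0 < e ->
  \forall r \near (0 : R)^'+, forall k, measurable_fun setT k ->
    (forall x, `|k x| <= r^-1) ->
    `|\int[mu]_(x in ball p r) (f x * k x) - f p * \int[mu]_(x in ball p r) k x| <= e.
Proof.
move=> fl fp e0; have := lebesgue_pt_small fl fp e0.
apply: filterS2 (nbhs_right_gt 0) => r r0 H k mk kr.
have mb : measurable (ball p r : set R) by exact: measurable_ball.
have ifk := locally_integrable_ballM p r fl mk kr.
have ik : mu.-integrable (ball p r) (EFin \o k).
  have := locally_integrable_ballM p r (locally_integrable_cst 1) mk kr.
  by congr (_.-integrable _ _); apply/funext => x /=; rewrite mul1r.
rewrite -RintegralZl// -RintegralB//; last first.
  exact: integrable_mulrl.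
have -> : \int[mu]_(x in ball p r) (f x * k x - f p * k x) =
  \int[mu]_(x in ball p r) ((f x - f p) * k x).
  by apply: eq_Rintegral => x _; rewrite mulrBl.
have flp := locally_integrableB fl (locally_integrable_cst (f p)).
have i1 := locally_integrable_ballM p r flp mk kr.
have i2 := integrable_norm (locally_integrable_ball p r flp).
apply: (le_trans (le_normr_Rintegral _ i1)) => //.
apply: (@le_trans _ _ (\int[mu]_(x in ball p r) (`|f x - f p| * r^-1))).
  apply: le_Rintegral => //.
  - exact: integrable_norm.
  - exact: integrable_mulrr.
  - by move=> x _; rewrite normrM ler_wpM2l.
by rewrite RintegralZr// ler_pdivrMr.
Qed.

End LebesguePoints.

(** * Weak derivatives tested against plateau functions *)

Section WeakDerivative.
Context {R : realType}.
Notation mu := (@lebesgue_measure R).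
Implicit Types (F G f k : R -> R) (p q r e h : R) (I D : set R).

Definition real_weak_derivative I F G : Prop :=
  forall w, test_function I w ->
    \int[mu]_(x in I) (F x * derive1 w x) = - \int[mu]_(x in I) (G x * w x).

Lemma derive1_plateau p q h x : 0 < h ->
  derive1 (fun y => step h (y - p) - step h (y - q)) x =
  tent h (x - p) - tent h (x - q).
Proof.
move=> h0; have := is_derive_step p x h0; have := is_derive_step q x h0.
move=> dq dp; rewrite derive1E; exact: derive_val.
Qed.

(** Left of p - h both steps are 0 and right of q + h both are 1, so the difference has compact
    support. *)
Lemma test_function_plateau I p q h : 0 < h -> p <= q -> `[p - h, q + h] `<=` I ->
  test_function I (fun x => step h (x - p) - step h (x - q)).
Proof.
move=> h0 pq hI; split.
- move=> x; have := is_derive_step p x h0; have := is_derive_step q x h0.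
  by move=> dq dp; apply: ex_derive.
- rewrite (_ : derive1 _ = fun x => tent h (x - p) - tent h (x - q)).
    by move=> x; apply: cvgB; exact: continuous_tent.
  by apply/funext => x; exact: derive1_plateau.
- exists (p - h), (q + h); split => // x.
  rewrite in_itv/= negb_and -!ltNge => /orP[] xlt.
    by rewrite !step_le0 ?subrr//; lra.
  by rewrite !step_ge1 ?subrr//; lra.
Qed.

Lemma ballNE p h x : ~ ball p h x -> h <= `|x - p|.
Proof. by rewrite /ball/= -distrC => /negP; rewrite -leNgt. Qed.

Lemma measurable_tent p h : measurable_fun setT (fun x : R => tent h (x - p)).
Proof. by apply: continuous_measurable_fun; exact: continuous_tent. Qed.

Lemma continuous_step p h : 0 < h -> continuous (fun x => step h (x - p)).
Proof.
move=> h0 x; apply: differentiable_continuous; apply/derivable1_diffP.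
by have := is_derive_step p x h0 => d; exact: ex_derive.
Qed.

(** By the fundamental theorem of calculus: the primitive [step h] rises from 0 to 1 across the
    ball. *)
Lemma Rintegral_tent p h : 0 < h -> \int[mu]_(x in ball p h) tent h (x - p) = 1.
Proof.
move=> h0.
have ct : {within `[p - h, p + h], continuous (fun x => tent h (x - p))}.
  by apply: continuous_subspaceT; exact: continuous_tent.
have it : mu.-integrable `[p - h, p + h] (EFin \o (fun x => tent h (x - p))).
  by apply: continuous_compact_integrable => //; exact: segment_compact.
rewrite ball_itv.
have lt : p - h < p + h by lra.
have dstep x : derivable (fun y => step h (y - p)) x 1.
  by have := is_derive_step p x h0 => d; exact: ex_derive.
have cstep := @continuous_step p h h0.
rewrite Rintegral_itv_obnd_cbnd; last first.
  by apply: integrableS it => //; exact: subset_itvW.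
rewrite Rintegral_itv_bndo_bndc; last first.
  by apply: integrableS it => //; by apply: subset_itvl; rewrite bnd_simp.
rewrite /Rintegral (@continuous_FTC2 _ _ (fun x => step h (x - p)))//=.
- by rewrite step_ge1 ?step_le0 ?subr0//; lra.
- split; [by move=> x _|..].
  + exact/cvg_at_right_filter/cstep.
  + exact/cvg_at_left_filter/cstep.
- move=> x _; rewrite derive1E; have := is_derive_step p x h0 => d; exact: derive_val.
Qed.

(** The kernel estimate with error 1, applied to k / r, puts the integral of f k within r of f p
    times the integral of k; the latter integral is at most 2 r. The total r (1 + 2 |f p|) explains
    the bound imposed on r. *)
Lemma lebesgue_pt_vanish f p e : locally_integrable setT f -> lebesgue_pt f p -> 0 < e ->
  \forall r \near (0 : R)^'+, forall k, measurable_fun setT k ->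
    (forall x, `|k x| <= 1) -> `|\int[mu]_(x in ball p r) (f x * k x)| <= e.
Proof.
move=> fl fp e0; have := lebesgue_pt_kernel fl fp ltr01.
have M0 : 0 < 1 + 2 * `|f p| by rewrite ltr_pwDl ?mulr_ge0.
apply: filterS3 (nbhs_right_le (divr_gt0 e0 M0)) (nbhs_right_gt 0) => r re r0 H k mk k1.
have mb : measurable (ball p r : set R) by exact: measurable_ball.
have mkr : measurable_fun setT (fun x => k x * r^-1).
  by apply: measurable_funM => //; exact: measurable_cst.
have rV : `|r^-1| = r^-1 by rewrite ger0_norm// invr_ge0 ltW.
have kr x : `|k x * r^-1| <= r^-1 by rewrite normrM rV ler_piMl// invr_ge0 ltW.
have := H _ mkr kr.
have ifk := locally_integrable_ballM p r fl mk k1.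
have ik : mu.-integrable (ball p r) (EFin \o k).
  have := locally_integrable_ballM p r (locally_integrable_cst 1) mk k1.
  by congr (_.-integrable _ _); apply/funext => x /=; rewrite mul1r.
under eq_Rintegral do rewrite mulrA.
rewrite RintegralZr// RintegralZr// mulrA -mulrBl normrM rV.
rewrite ler_pdivrMr// mul1r => H1.
have kb : `|\int[mu]_(x in ball p r) k x| <= 2 * r.
  apply: (le_trans (le_normr_Rintegral _ ik)) => //.
  apply: (@le_trans _ _ (\int[mu]_(x in ball p r) cst 1 x)).
    apply: le_Rintegral => //; first exact: integrable_norm.
    exact: (locally_integrable_ball p r (locally_integrable_cst 1)).
  rewrite Rintegral_cst; last exact: mb.
  by rewrite mul1r (congr1 fine (lebesgue_measure_ball p (ltW r0)))/= -[r *+ 2]mulr_natl.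
have : `|f p * \int[mu]_(x in ball p r) k x| <= `|f p| * (2 * r).
  by rewrite normrM ler_wpM2l.
move: re; rewrite ler_pdivlMr// => re H2.
rewrite -(subrK (f p * \int[mu]_(x in ball p r) k x) (\int[mu]_(x in ball p r) (f x * k x))).
apply: le_trans (ler_normD _ _) _; apply: le_trans (lerD H1 H2) _.
by move: re; clear; lra.
Qed.

Lemma normr_tent p h x : 0 < h -> `|tent h (x - p)| <= h^-1.
Proof. by move=> h0; rewrite ger0_norm ?tent_ge0// tent_le. Qed.

Lemma measurable_stepB (i : interval R) p h : 0 < h ->
  measurable_fun setT (fun x : R => step h (x - p) - (x \in i)%:R).
Proof.
move=> h0; apply: measurable_funB.
  by apply: continuous_measurable_fun; exact: continuous_step.
rewrite (_ : (fun x => _) = \1_[set` i]); first exact: measurable_indic.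
by apply/funext => x; rewrite indicE mem_setE.
Qed.

Lemma normr_stepB (b : bool) p h x : 0 < h -> `|step h (x - p) - b%:R| <= 1.
Proof.
move=> h0; have /andP[? ?] := step_bound (x - p) h0.
by rewrite ler_norml; apply/andP; case: b; rewrite /= ?mulr1n ?mulr0n; split; lra.
Qed.

(** Away from the ball the smoothed step equals the sharp one, whose value is b. The jump point c
    lies in the ball, so either convention for the sharp step at c is allowed. *)
Lemma stepB_eq0 (b : bool) (c r x : R) : 0 < r -> ~ ball c r x ->
  (x < c -> b = false) -> (c < x -> b) -> step r (x - c) - b%:R = 0.
Proof.
move=> r0 /ballNE; rewrite ler_normr => /orP[] xc blt bgt.
  by rewrite step_ge1// bgt ?subrr//; lra.
by rewrite step_le0 ?blt ?subrr//; lra.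
Qed.

(** The indicator of [p, q] is that of [p, +oo[ minus that of ]q, +oo[. With a and b the smoothed
    steps at p and q, the remaining two terms are errors supported near p and near q. *)
Lemma itv_indicB (y a b x p q : R) : p <= q ->
  y * (a - b) = (if p <= x <= q then y else 0) +
    y * (a - (p <= x)%R%:R) - y * (b - (q < x)%R%:R).
Proof.
move=> pq; case: (leP p x) => px; case: (leP x q) => xq.
- by rewrite /= mulr1n mulr0n; ring.
- by rewrite /= mulr1n; ring.
- by rewrite /= mulr0n; ring.
- by have := lt_trans (lt_le_trans px pq) xq; rewrite ltxx.
Qed.

(* The test function [step r (x - p) - step r (x - q)] tends to the indicator of
   [p, q] when r -> 0, and its derivative averages around p and q. *)
Lemma real_weak_derivative_increment I F G p q d :
  locally_integrable setT (F \_ I) -> locally_integrable setT (G \_ I) ->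
  real_weak_derivative I F G -> p <= q -> 0 < d -> `[p - d, q + d] `<=` I ->
  lebesgue_pt (F \_ I) p -> lebesgue_pt (F \_ I) q ->
  lebesgue_pt (G \_ I) p -> lebesgue_pt (G \_ I) q ->
  (F \_ I) q - (F \_ I) p = \int[mu]_(x in `[p, q]) (G \_ I) x.
Proof.
(* Two errors come from averaging F near p and q, two from replacing smoothed steps by sharp ones
   under the integral of G; each gets e / 4. *)
have arith (e a b c d' x y z : R) : `|a - x| <= e / 4 -> `|b - y| <= e / 4 ->
    `|c| <= e / 4 -> `|d'| <= e / 4 -> a - b = - (z + c - d') -> `|y - x - z| <= e.
  clear; rewrite !ler_norml => /andP[? ?] /andP[? ?] /andP[? ?] /andP[? ?] ?.
  by apply/andP; split; lra.
set f := F \_ I; set g := G \_ I => fl gl FG pq d0 dI fp fq gp gq.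
apply/eqP; rewrite -subr_eq0 -normr_le0; apply/ler_addgt0Pr => e e0; rewrite add0r.
have e40 : 0 < e / 4 by rewrite divr_gt0.
have Dfg w : test_function I w ->
    \int[mu]_x (f x * derive1 w x) = - \int[mu]_x (g x * w x).
  move=> /FG; rewrite [in X in X -> _]Rintegral_mkcond.
  rewrite [X in - X]Rintegral_mkcond => FGE.
  transitivity (\int[mu]_x ((fun x => F x * derive1 w x) \_ I) x).
    apply: eq_Rintegral => x _; rewrite /f !patchE.
    by case: ifP => // _; rewrite mul0r.
  rewrite FGE; congr (- _); apply: eq_Rintegral => x _; rewrite /g !patchE.
  by case: ifP => // _; rewrite mul0r.
have Np := lebesgue_pt_kernel fl fp e40; have Nq := lebesgue_pt_kernel fl fq e40.
have Mp := lebesgue_pt_vanish gl gp e40; have Mq := lebesgue_pt_vanish gl gq e40.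
(* One radius r serves all four estimates and, being at most d, keeps the support of the plateau
   inside I. *)
have [r [[[Npr Nqr] [Mpr Mqr]] [r0 rd]]] := filter_ex (filterI (filterI (filterI Np Nq)
  (filterI Mp Mq)) (filterI (nbhs_right_gt (0 : R)) (nbhs_right_le d0))).
have Kf c : (forall k, measurable_fun setT k -> (forall x, `|k x| <= r^-1) ->
      `|\int[mu]_(x in ball c r) (f x * k x) -
        f c * \int[mu]_(x in ball c r) k x| <= e / 4) ->
    `|\int[mu]_(x in ball c r) (f x * tent r (x - c)) - f c| <= e / 4.
  move=> /(_ _ (measurable_tent c r) (fun x => normr_tent c x r0)).
  by rewrite Rintegral_tent// mulr1.
have Kg (i : interval R) c : (forall k, measurable_fun setT k ->
      (forall x, `|k x| <= 1) -> `|\int[mu]_(x in ball c r) (g x * k x)| <= e / 4) ->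
    `|\int[mu]_(x in ball c r) (g x * (step r (x - c) - (x \in i)%:R))| <= e / 4.
  by move=> /(_ _ (measurable_stepB i c r0) (fun x => normr_stepB _ c x r0)).
have Kfp := Kf p Npr; have Kfq := Kf q Nqr.
have Kgp := Kg `[p, +oo[ p Mpr; have Kgq := Kg `]q, +oo[ q Mqr.
have rI : `[p - r, q + r] `<=` I.
  by apply: subset_trans dI; apply: subset_itvScc; rewrite bnd_simp ?lerD2l ?lerN2.
have := Dfg _ (test_function_plateau r0 pq rI).
have mb c : measurable (ball c r : set R) by exact: measurable_ball.
have tE c x : ~ ball c r x -> f x * tent r (x - c) = 0.
  by move=> /ballNE/(tent_eq0 r0) ->; rewrite mulr0.
have ift c : mu.-integrable setT (EFin \o (fun x => f x * tent r (x - c))).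
  apply: (@integrable_supp _ _ _ mu _ _ (mb c) (tE c)).
  exact: (locally_integrable_ballM _ _ fl (measurable_tent c r) (fun x => normr_tent c x r0)).
have -> : \int[mu]_x (f x * derive1 (fun x => step r (x - p) - step r (x - q)) x) =
  \int[mu]_(x in ball p r) (f x * tent r (x - p)) -
  \int[mu]_(x in ball q r) (f x * tent r (x - q)).
  under eq_Rintegral do rewrite derive1_plateau// mulrBr.
  by rewrite RintegralB//; congr (_ - _); apply: Rintegral_supp; exact: tE.
have sEp x : ~ ball p r x -> g x * (step r (x - p) - (x \in `[p, +oo[)%:R) = 0.
  move=> xp; rewrite stepB_eq0 ?mulr0//; rewrite in_itv/= andbT.
    by rewrite ltNge => /negbTE.
  exact: ltW.
have sEq x : ~ ball q r x -> g x * (step r (x - q) - (x \in `]q, +oo[)%:R) = 0.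
  move=> xp; rewrite stepB_eq0 ?mulr0//; rewrite in_itv/= andbT//.
  by move=> xq; apply/negbTE; rewrite -leNgt ltW.
have igs (i : interval R) c :
    (forall x, ~ ball c r x -> g x * (step r (x - c) - (x \in i)%:R) = 0) ->
  mu.-integrable setT (EFin \o (fun x => g x * (step r (x - c) - (x \in i)%:R))).
  move=> gE; apply: (@integrable_supp _ _ _ mu _ _ (mb c) gE).
  exact: (locally_integrable_ballM _ _ gl (measurable_stepB i c r0)
    (fun x => normr_stepB _ c x r0)).
have igpq : mu.-integrable setT (EFin \o (g \_ `[p, q])).
  rewrite -restrict_EFin -integrable_mkcond//.
  exact: (@locally_integrable_itv _ _ _ p q).
have -> : \int[mu]_x (g x * (step r (x - p) - step r (x - q))) =
  \int[mu]_(x in `[p, q]) g x +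
  \int[mu]_(x in ball p r) (g x * (step r (x - p) - (x \in `[p, +oo[)%:R)) -
  \int[mu]_(x in ball q r) (g x * (step r (x - q) - (x \in `]q, +oo[)%:R)).
  transitivity (\int[mu]_x (g \_ `[p, q]) x +
      \int[mu]_x (g x * (step r (x - p) - (x \in `[p, +oo[)%:R)) -
      \int[mu]_x (g x * (step r (x - q) - (x \in `]q, +oo[)%:R))); last first.
    by rewrite -Rintegral_mkcond; congr (_ + _ - _); apply: Rintegral_supp; [exact: sEp|exact: sEq].
  have ip := igs _ _ sEp; have iq := igs _ _ sEq.
  rewrite -RintegralD// -RintegralB//; last exact: integrable_addr.
  apply: eq_Rintegral => x _; rewrite patchE mem_setE !in_itv/= !andbT.
  exact: (itv_indicB _ _ _ _ pq).
exact: arith Kfp Kfq Kgp Kgq.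
Qed.

End WeakDerivative.

(** * Product rule for primitives of integrable functions *)

Section AbsolutelyContinuousProduct.
Context {R : realType}.
Notation mu := (@lebesgue_measure R).
Notation T := (measurableTypeR R).
Implicit Types (g h U V : R -> R) (a b : R).

Lemma EFin_Rintegral D (f : T -> R) : measurable D -> mu.-integrable D (EFin \o f) ->
  (\int[mu]_(x in D) f x)%:E = (\int[mu]_(x in D) (f x)%:E)%E.
Proof. by move=> mD fi; rewrite /Rintegral fineK// integrable_fin_num. Qed.

(** By Tonelli, g(x) h(y) has the product of the two L^1 norms as its norm; the indicator is at most
    1. *)
Lemma integrable_prod_indic g h (B : set (T * T)) :
  mu.-integrable setT (EFin \o g) -> mu.-integrable setT (EFin \o h) ->
  measurable B ->
  (mu \x mu)%E.-integrable setT (EFin \o (fun z : T * T => g z.1 * h z.2 * \1_B z)).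
Proof.
move=> gi hi mB.
have mg : measurable_fun [set: T] g by apply/measurable_EFinP; exact: measurable_int gi.
have mh : measurable_fun [set: T] h by apply/measurable_EFinP; exact: measurable_int hi.
have mgh : measurable_fun [set: T * T] (fun z => g z.1 * h z.2).
  by apply: measurable_funM; exact: measurableT_comp.
have mf : measurable_fun [set: T * T] (fun z => g z.1 * h z.2 * \1_B z).
  by apply: measurable_funM => //; exact: measurable_indic.
have ig : (mu \x mu)%E.-integrable setT (EFin \o (fun z : T * T => g z.1 * h z.2)).
  apply/integrable12ltyP; first exact/measurable_EFinP.
  have ni := integrable_norm gi; have nh := integrable_norm hi.
  rewrite (_ : (fun x => _) = (fun x => (`|g x| * \int[mu]_y `|h y|)%:E)); last first.
    apply/funext => x; rewrite EFinM EFin_Rintegral// -integralZl//.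
    by apply: eq_integral => y _ /=; rewrite normrM EFinM.
  rewrite (_ : (fun x => _) = (fun x => (`|g x|)%:E * (\int[mu]_y `|h y|)%:E)%E)//.
  by rewrite integralZr// -EFin_Rintegral// -EFinM ltry.
apply: le_integrable ig => //; first exact/measurable_EFinP.
move=> z _; rewrite lee_fin normrM ler_piMr// indicE.
by case: (z \in B); rewrite /= ?normr1 ?normr0.
Qed.

Lemma Rintegral_swap_indic g h (B : set (T * T)) :
  mu.-integrable setT (EFin \o g) -> mu.-integrable setT (EFin \o h) ->
  measurable B ->
  mu.-integrable setT (EFin \o (fun x => g x * \int[mu]_y (h y * \1_B (x, y)))) /\
      \int[mu]_x (g x * \int[mu]_y (h y * \1_B (x, y))) =
      \int[mu]_y (h y * \int[mu]_x (g x * \1_B (x, y))).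
Proof.
move=> gi hi mB; have ik := integrable_prod_indic gi hi mB.
have mi : measurable_fun [set: T * T] (\1_B : T * T -> R) by exact: measurable_indic.
have i01 (z : T * T) : `|\1_B z : R| <= 1.
  by rewrite indicE; case: (z \in B); rewrite /= ?normr1 ?normr0.
have mg : measurable_fun [set: T] g by apply/measurable_EFinP; exact: measurable_int gi.
have mh : measurable_fun [set: T] h by apply/measurable_EFinP; exact: measurable_int hi.
have ih x : mu.-integrable setT (EFin \o (fun y => h y * \1_B (x, y))).
  apply: le_integrable hi => //.
    apply/measurable_EFinP/measurable_funM => //.
    exact: (measurableT_comp mi (pair1_measurable x)).
  by move=> y _; rewrite lee_fin normrM ler_piMr.
have ig y : mu.-integrable setT (EFin \o (fun x => g x * \1_B (x, y))).
  apply: le_integrable gi => //.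
    apply/measurable_EFinP/measurable_funM => //.
    exact: (measurableT_comp mi (pair2_measurable y)).
  by move=> x _; rewrite lee_fin normrM ler_piMr.
have FE : (fun x => \int[mu]_y (g x * h y * \1_B (x, y))%:E)%E =
    EFin \o (fun x => g x * \int[mu]_y (h y * \1_B (x, y))).
  apply/funext => x /=; rewrite EFinM EFin_Rintegral; [|by []|exact: ih].
  rewrite -integralZl; [|by []|exact: ih].
  by apply: eq_integral => y _; rewrite -EFinM mulrA.
have GE : (fun y => \int[mu]_x (g x * h y * \1_B (x, y))%:E)%E =
    EFin \o (fun y => h y * \int[mu]_x (g x * \1_B (x, y))).
  apply/funext => y /=; rewrite EFinM EFin_Rintegral; [|by []|exact: ig].
  rewrite -integralZl; [|by []|exact: ig].
  by apply: eq_integral => x _; rewrite -EFinM mulrCA mulrA.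
split.
- by have := integrable_fubini_F ik; rewrite /fubini_F /= FE.
- have := Fubini ik; rewrite /= FE GE => FG.
  exact: (congr1 fine FG).
Qed.

Lemma integrable_restrict_itv (i : interval R) g :
  mu.-integrable [set` i] (EFin \o g) -> mu.-integrable setT (EFin \o (g \_ [set` i])).
Proof. by move=> gi; rewrite -restrict_EFin -integrable_mkcond. Qed.

Definition below_diagonal : set (T * T) := [set z | z.2 <= z.1].

Lemma measurable_below_diagonal : measurable below_diagonal.
Proof. by rewrite -[below_diagonal]setTI; apply: measurable_fun_le. Qed.

Lemma below_diagonalE (x y : R) : \1_below_diagonal (x, y) = (y <= x)%R%:R :> R.
Proof.
rewrite indicE (_ : (_ \in _) = (y <= x))//.
by apply/idP/idP => [/set_mem|yx]; [|exact: mem_set].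
Qed.

Lemma Rintegral_below_left a b h (x : R) : x <= b ->
  \int[mu]_y ((h \_ `[a, b]) y * \1_below_diagonal (x, y)) = \int[mu]_(y in `[a, x]) h y.
Proof.
move=> xb; rewrite [RHS]Rintegral_mkcond; apply: eq_Rintegral => y _.
rewrite below_diagonalE !patchE !mem_setE !in_itv/=.
have [yx|yx] := leP y x; last by rewrite mulr0 andbF.
by rewrite mulr1 (le_trans yx xb).
Qed.

Lemma Rintegral_below_right a b g (y : R) : a <= y ->
  \int[mu]_x ((g \_ `[a, b]) x * \1_below_diagonal (x, y)) = \int[mu]_(x in `[y, b]) g x.
Proof.
move=> ay; rewrite [RHS]Rintegral_mkcond; apply: eq_Rintegral => x _.
rewrite below_diagonalE !patchE !mem_setE !in_itv/=.
have [yx|yx] := leP y x; last by rewrite mulr0.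
by rewrite mulr1 (le_trans ay yx).
Qed.

(** Isolates the double integral: h stands for the inner integral over a section of the triangle, of
    which V is an affine function on [a, b]. *)
Lemma Rintegral_affine a b g h V c r :
  mu.-integrable `[a, b] (EFin \o g) ->
  mu.-integrable setT (EFin \o (fun x => (g \_ `[a, b]) x * h x)) ->
  (forall x, a <= x <= b -> V x = c + r * h x) ->
  \int[mu]_(x in `[a, b]) (g x * V x) =
  r * \int[mu]_x ((g \_ `[a, b]) x * h x) + (\int[mu]_(x in `[a, b]) g x) * c.
Proof.
move=> ig igh VE.
have -> : \int[mu]_(x in `[a, b]) (g x * V x) =
    \int[mu]_(x in `[a, b]) (r * ((g \_ `[a, b]) x * h x) + g x * c).
  apply: eq_Rintegral => x xab; rewrite patchE xab.
  by move: xab; rewrite mem_setE in_itv/= => /VE ->; ring.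
have igh' : mu.-integrable `[a, b] (EFin \o (fun x => (g \_ `[a, b]) x * h x)).
  by apply: (@integrableS _ _ _ mu setT) igh => //; exact: measurable_itv.
rewrite RintegralD//; [|exact: integrable_mulrl|exact: integrable_mulrr].
rewrite RintegralZr// RintegralZl//; congr (_ * _ + _).
rewrite Rintegral_mkcond; apply: eq_Rintegral => x _; rewrite !patchE.
by case: ifP => [->//|_]; rewrite mul0r.
Qed.

(* Up to boundary terms, the two integrals are the integrals of g(x) h(y) over
   the two triangles y <= x and x <= y of the square [a, b]^2. *)
Lemma Rintegral_product a b U V g h : a <= b ->
  mu.-integrable `[a, b] (EFin \o g) -> mu.-integrable `[a, b] (EFin \o h) ->
  (forall x, a <= x <= b -> U x = U a + \int[mu]_(t in `[a, x]) g t) ->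
  (forall x, a <= x <= b -> V x = V a + \int[mu]_(t in `[a, x]) h t) ->
  \int[mu]_(x in `[a, b]) (g x * V x) + \int[mu]_(x in `[a, b]) (h x * U x) =
  U b * V b - U a * V a.
Proof.
move=> ab gi hi UE VE.
have gi0 := integrable_restrict_itv gi; have hi0 := integrable_restrict_itv hi.
have [IV SW] := Rintegral_swap_indic gi0 hi0 measurable_below_diagonal.
(* [Rintegral_swap_indic] gives integrability in its first variable only. Here it is used with g and
   h exchanged and the transposed triangle, whose indicator at (y, x) is that of [below_diagonal] at
   (x, y). *)
have IU : mu.-integrable setT (EFin \o (fun y => (h \_ `[a, b]) y *
    \int[mu]_x ((g \_ `[a, b]) x * \1_below_diagonal (x, y)))).
  have mB' : measurable [set z : T * T | z.1 <= z.2].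
    by rewrite -[[set _ | _]]setTI; apply: measurable_fun_le.
  exact: (Rintegral_swap_indic hi0 gi0 mB').1.
have bb : a <= b <= b by rewrite ab lexx.
rewrite (Rintegral_affine (c := V a) (r := 1) gi IV); last first.
  move=> x /[dup] /VE -> /andP[_ xb]; clear UE VE SW.
  by rewrite Rintegral_below_left// mul1r.
(* V was expanded from the left end a; U is expanded from the right end b, as U b minus the integral
   of g over [x, b]. The double integrals then range over the same triangle with opposite signs and
   cancel. *)
rewrite (Rintegral_affine (c := U b) (r := -1) hi IU); last first.
  move=> x /[dup] /UE -> /andP[ax xb]; rewrite (UE b bb); clear UE VE SW.
  rewrite Rintegral_below_right// -(Rintegral_itv_obnd_cbnd (r := x)); last first.
    by apply: integrableS gi => //; apply: subset_itv; rewrite bnd_simp.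
  rewrite -(Rintegral_itvB gi) ?bnd_simp//.
  by move: (Rintegral _ _ _) (Rintegral _ _ _); clear; move=> A B; ring.
rewrite SW (UE b bb) (VE b bb).
move: (Rintegral _ _ _) (Rintegral _ _ _) (Rintegral _ _ _); clear; move=> A B C; ring.
Qed.

End AbsolutelyContinuousProduct.

(** * Almost everywhere equality and integrals over rays *)

Section AlmostEverywhere.
Context {R : realType}.
Notation mu := (@lebesgue_measure R).
Implicit Types (f g U : R -> R) (a b x : R) (I : set R).

Lemma ae_imp (P Q : R -> Prop) : {ae mu, forall x, P x} -> (forall x, P x -> Q x) ->
  {ae mu, forall x, Q x}.
Proof. by move=> aeP PQ; apply: negligibleS aeP => x /= nQ /PQ. Qed.

Lemma ae_and (P Q : R -> Prop) : {ae mu, forall x, P x} -> {ae mu, forall x, Q x} ->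
  {ae mu, forall x, P x /\ Q x}.
Proof.
move=> aeP aeQ; apply: negligibleS (negligibleU aeP aeQ) => x /=.
by rewrite -not_andE.
Qed.

(** A nonempty open set contains a ball, hence has positive measure and cannot lie in a null set. *)
Lemma ae_open_ex (P : set R) I : open I -> I !=set0 -> {ae mu, forall x, P x} ->
  exists2 x, I x & P x.
Proof.
move=> oI [x0 Ix0] aeP; apply: contrapT => nex.
have nI : mu.-negligible I by apply: negligibleS aeP => x Ix Px; apply: nex; exists x.
have mI0 : mu I = 0%E by apply: measure_negligible nI; exact: open_measurable.
have /nbhs_ballP[r /= r0 rI] : nbhs x0 I by exact: open_nbhs_nbhs.
have : (mu (ball x0 r) <= mu I)%E.
  by apply: le_measure => //; rewrite inE; [exact: measurable_ball|exact: open_measurable].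
have mb : mu (ball x0 r) = (r *+ 2)%:E := lebesgue_measure_ball x0 (ltW r0).
rewrite mb mI0 lee_fin leNgt.
by rewrite mulrn_wgt0.
Qed.

Lemma ae_neq a : {ae mu, forall x, x <> a}.
Proof.
have n1 : mu.-negligible [set a].
  by apply/negligibleP; [exact: measurable_set1|exact: lebesgue_measure_set1].
by apply: negligibleS n1 => x /contrapT.
Qed.

Lemma ae_eq_Rintegral I f g : measurable I ->
  measurable_fun I f -> measurable_fun I g ->
  f = g %[ae mu in I] -> \int[mu]_(x in I) f x = \int[mu]_(x in I) g x.
Proof.
move=> mI mf mg fg; congr fine; apply: ae_eq_integral => //.
- exact/measurable_EFinP.
- exact/measurable_EFinP.
- exact: (ae_imp (Q := fun x => I x -> (f x)%:E = (g x)%:E) fg (fun x H Ix => congr1 EFin (H Ix))).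
Qed.

(** If f and g differed at a point of the closure, they would differ on a relative neighbourhood of
    it; this meets I in a nonempty open set, where some point satisfies f = g. *)
Lemma continuous_ae_eq I f g : open I ->
  {within closure I, continuous f} -> {within closure I, continuous g} ->
  f = g %[ae mu in I] -> {in closure I, f =1 g}.
Proof.
move=> oI cf cg fg x /set_mem Ix; apply/eqP; rewrite -subr_eq0; apply/eqP; apply: contrapT => h0.
move/subspace_continuousP : cf => /(_ _ Ix) cf.
move/subspace_continuousP : cg => /(_ _ Ix) cg.
have : \forall y \near within (closure I) (nbhs x), f y - g y != 0.
  have FF : Filter (within (closure I) (nbhs x)) by exact: within_filter.
  have H : (f y - g y) @[y --> within (closure I) (nbhs x)] --> f x - g x.
    by apply: cvgB; [exact: cf|exact: cg].
  by apply: (cvgr_neq0 (f x - g x) H); exact/eqP.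
rewrite /within/= nbhsE/= => -[B [oB Bx] BI].
have [y [By Iy] fgy] : exists2 y, (B `&` I) y & I y -> f y = g y.
  apply: ae_open_ex fg; first exact: openI.
  by rewrite setIC; exact: Ix (open_nbhs_nbhs (conj oB Bx)).
by have := BI y By (subset_closure Iy); rewrite fgy// subrr eqxx.
Qed.

(** |f| <= 1 + f^2, and the right-hand side is integrable on compact sets. *)
Lemma Lfun2_locally_integrable f : f \in Lfun mu 2%:E -> locally_integrable setT f.
Proof.
move=> fl; have f2 := Lfun2_integrable_sqr fl.
have mf : measurable_fun setT f by move: fl => /sub_Lfun_mfun; rewrite inE.
split => //; first exact: openT.
move=> K _ cK.
have iK : mu.-integrable K (EFin \o (fun x => 1 + f x ^+ 2)).
  apply: integrable_addr.
  - exact: compact_measurable.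
  - apply/integrableP; split; first exact/measurable_EFinP/measurable_cst.
    by have [_ _] := locally_integrable_cst (1 : R); apply.
  - by apply: (@integrableS _ _ _ mu setT) f2 => //; exact: compact_measurable.
suff : mu.-integrable K (EFin \o f) by case/integrableP.
apply: le_integrable iK => //.
- exact: compact_measurable.
- exact/measurable_EFinP/measurable_funTS.
- move=> x _; rewrite lee_fin [leRHS]ger0_norm ?addr_ge0 ?sqr_ge0//.
  rewrite -[f x ^+ 2]real_normK ?num_real//.
  have := sqr_ge0 (`|f x| - 1); have := normr_ge0 (f x).
  by move: `|f x| => y; nra.
Qed.

Lemma ge0_subset_Rintegral (A B : set R) f : measurable (A : set (measurableTypeR R)) ->
  measurable (B : set (measurableTypeR R)) -> A `<=` B ->
  mu.-integrable B (EFin \o f) -> (forall x, 0 <= f x) ->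
  \int[mu]_(x in A) f x <= \int[mu]_(x in B) f x.
Proof.
move=> mA mB AB fi f0; have fA : mu.-integrable A (EFin \o f) by apply: integrableS fi.
rewrite fine_le ?integrable_fin_num//.
apply: ge0_subset_integral => //; last by move=> x _; rewrite lee_fin.
exact: measurable_int fi.
Qed.

(** Dominated convergence: the truncations of |f| to [n, +oo[ tend pointwise to 0 and are dominated
    by |f|. *)
Lemma integral_tail f e : mu.-integrable setT (EFin \o f) -> 0 < e ->
  \forall n \near \oo, \int[mu]_(x in `[n%:R, +oo[) `|f x| <= e.
Proof.
move=> fi e0.
have nf : mu.-integrable setT (EFin \o (fun x => `|f x|)) by exact: integrable_norm.
pose F (n : nat) := EFin \o ((fun x => `|f x|) \_ `[n%:R, +oo[).
have FE (n : nat) x : F n x = if n%:R <= x then (`|f x|)%:E else 0%E.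
  by rewrite /F /= patchE mem_setE in_itv/= andbT; case: ifP.
have mF n : measurable_fun setT (F n).
  apply/measurable_EFinP/(measurable_restrictT _ _).1 => //.
  by apply/measurable_funTS/measurable_EFinP; exact: measurable_int nf.
have cF : (\int[mu]_x F n x)%E @[n --> \oo] --> (\int[mu]_x cst 0%E x)%E.
  apply: (@dominated_cvg _ _ _ mu setT measurableT F (cst 0%E) (EFin \o (fun x => `|f x|))) => //.
  - move=> x _; apply: cvg_near_cst; near=> n; rewrite FE leNgt.
    by rewrite (_ : x < n%:R)//; near: n; exact: nbhs_infty_gtr.
  - move=> n x _; rewrite FE; case: ifP => _ /=; last by rewrite lee_fin normr0.
    by rewrite normr_id.
move: cF; rewrite integral0 => /fine_cvgP[_ /cvgrPdist_le /= /(_ _ e0)].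
apply: filterS => n; rewrite sub0r normrN; apply: le_trans.
by rewrite Rintegral_mkcond; exact: ler_norm.
Unshelve. all: by end_near. Qed.

Lemma Rintegral_itv1 c (n : nat) : \int[mu]_(x in `[n%:R, n.+1%:R]) (cst c x) = c :> R.
Proof.
rewrite Rintegral_cst; last exact: measurable_itv.
have := @lebesgue_measure_itv R `[n%:R, n.+1%:R] => H.
rewrite (congr1 fine H)/= lte_fin ltr_nat ltnSn/= -natrB// subSnn mulr1//.
Qed.

(* The integrable function U tends to the integral of f at infinity.  Its mean over
   [n, n + 1] is small, and so is its distance to the integral of f there. *)
Lemma Rintegral_ray_eq0 a f U : mu.-integrable setT (EFin \o f) ->
  (forall x, x <= a -> f x = 0) ->
  mu.-integrable `[a, +oo[ (EFin \o U) ->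
  (forall x, a <= x -> U x = \int[mu]_(t in `[a, x]) f t) ->
  \int[mu]_x f x = 0.
Proof.
move=> fi fa Ui UE; apply/eqP; rewrite -normr_le0; apply/ler_addgt0Pr => e e0; rewrite add0r.
have e20 : 0 < e / 2 by rewrite divr_gt0.
have iray (F : R -> R) (i : interval R) : mu.-integrable setT (EFin \o F) ->
    mu.-integrable [set` i] (EFin \o F).
  by move=> Fi; apply: (@integrableS _ _ _ mu setT) Fi => //; exact: measurable_itv.
have Ui' : mu.-integrable setT (EFin \o (U \_ `[a, +oo[)).
  exact: integrable_restrict_itv.
have [n [[tf tU] an]] := filter_ex (filterI (filterI (integral_tail fi e20)
  (integral_tail Ui' e20)) (nbhs_infty_ger a)).
have nsub : `[n%:R : R, n.+1%:R] `<=` `[n%:R, +oo[ by apply: subset_itvl; rewrite bnd_simp.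
have asub : `[n%:R : R, n.+1%:R] `<=` `[a, +oo[.
  by apply: subset_trans nsub _; apply: subset_itvr; rewrite bnd_simp.
have iU : mu.-integrable `[n%:R, n.+1%:R] (EFin \o U).
  by apply: integrableS Ui.
set l := \int[mu]_x f x.
have lU x : n%:R <= x -> `|l - U x| <= e / 2.
  move=> nx; have ax := le_trans an nx.
  have lE : l = \int[mu]_(t in `[a, +oo[) f t.
    apply: Rintegral_supp => t /=; rewrite in_itv/= andbT => /negP.
    by rewrite -ltNge => /ltW/fa.
  rewrite lE UE//; clear lE UE.
  (* l - U x is the integral of f beyond x, bounded by the tail of |f| beyond n. *)
  rewrite Rintegral_itvB ?bnd_simp//; last exact: iray.
  apply: (le_trans (le_normr_Rintegral _ (iray _ _ fi))) => //.
  apply: le_trans tf; apply: ge0_subset_Rintegral => //.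
    by apply: subset_itvr; rewrite bnd_simp.
  by apply: iray; exact: integrable_norm.
have lUn : `|\int[mu]_(x in `[n%:R, n.+1%:R]) U x| <= e / 2.
  clear lU UE; apply: (le_trans (le_normr_Rintegral _ iU)) => //; apply: le_trans tU.
  have -> : \int[mu]_(x in `[n%:R, n.+1%:R]) `|U x| =
      \int[mu]_(x in `[n%:R, n.+1%:R]) `|(U \_ `[a, +oo[) x|.
    by apply: eq_Rintegral => x /set_mem/asub/mem_set; rewrite patchE => ->.
  apply: ge0_subset_Rintegral => //.
  by apply: iray; exact: integrable_norm.
have il c : mu.-integrable `[n%:R, n.+1%:R] (EFin \o cst c).
  by apply: (@locally_integrable_itv _ _ _ n%:R n.+1%:R) => //; exact: locally_integrable_cst.
(* The interval has length 1, so the constant l is its own integral there. *)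
have -> : l = \int[mu]_(x in `[n%:R, n.+1%:R]) (l - U x) + \int[mu]_(x in `[n%:R, n.+1%:R]) U x.
  clear UE; rewrite RintegralB//; last exact: il.
  by rewrite subrK (Rintegral_itv1 l n).
clear UE; rewrite (le_trans (ler_normD _ _))// [leRHS](splitr e) lerD//.
have ilU : mu.-integrable `[n%:R, n.+1%:R] (EFin \o (fun x => l - U x)).
  by apply: integrable_subr => //; exact: il.
apply: (le_trans (le_normr_Rintegral _ ilU)) => //.
rewrite -[leRHS](Rintegral_itv1 _ n).
apply: le_Rintegral => //; first exact: integrable_norm.
by move=> x; rewrite /= in_itv/= => /andP[nx _]; exact: lU.
Qed.

End AlmostEverywhere.

(** * Continuous representatives *)

Section Representative.
Context {R : realType}.
Notation mu := (@lebesgue_measure R).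
Implicit Types (f g U F G : R -> R) (a b x : R) (I : set R).

(** The common shape of the two edges: the last clause makes I an interval that begins right after
    a, and its right end may be finite or infinite. *)
Definition ray_interval a I : Prop :=
  [/\ open I, I !=set0, I `<=` `]a, +oo[ & forall x, I x -> `]a, x] `<=` I].

Definition real_L2 I F : Prop := F \_ I \in Lfun mu 2%:E.

(** Continuity is required on the whole line, so that U has a value at the end points of the edge
    and is measurable everywhere. *)
Definition primitive_of a g U : Prop :=
  continuous U /\ forall x, a <= x -> U x = U a + \int[mu]_(t in `[a, x]) g t.

Lemma parameterized_integral_shift a b g : b <= a -> (forall x, x <= a -> g x = 0) ->
  parameterized_integral mu b ^~ g = parameterized_integral mu a ^~ g.
Proof.
move=> ba ga; apply/funext => x; rewrite /parameterized_integral.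
rewrite [LHS]Rintegral_mkcond [RHS]Rintegral_mkcond; apply: eq_Rintegral => t _.
rewrite !patchE !mem_setE !in_itv/=; have [tx|tx] := leP t x; last by rewrite !andbF.
rewrite !andbT; case: (leP a t) => at_; first by rewrite (le_trans ba at_).
by case: ifP => // _; rewrite ga// ltW.
Qed.

Lemma continuous_primitive a g : locally_integrable setT g -> (forall x, x <= a -> g x = 0) ->
  continuous (parameterized_integral mu a ^~ g).
Proof.
move=> gl ga x.
(* The base point moves below both a and x, which changes nothing because g vanishes left of a. Now
   x is interior to [a', b'], and continuity on that segment gives continuity at x. *)
pose a' := Num.min a x - 1; pose b' := x + 1.
have a'a : a' <= a by rewrite /a' lerBlDr ge_min lerDl ler01.
have ax : a' < x < b'.
  by rewrite /a' /b' ltrBlDr gt_min; apply/andP; split; [apply/orP; right; lra|lra].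
have a'b' : a' < b' by case/andP: ax => ? ?; lra.
have gi : mu.-integrable `[a', b'] (EFin \o g) by exact: (@locally_integrable_itv _ _ _ a' b').
have := parameterized_integral_continuous (ltW a'b') gi.
rewrite (parameterized_integral_shift a'a ga) => /(continuous_within_itvP _ a'b')[+ _ _].
by apply; rewrite in_itv.
Qed.

Lemma Rintegral_itv_diff a g p q : locally_integrable setT g -> a <= p -> p <= q ->
  \int[mu]_(t in `[p, q]) g t =
  \int[mu]_(t in `[a, q]) g t - \int[mu]_(t in `[a, p]) g t.
Proof.
move=> gl ap pq; rewrite Rintegral_itvB ?bnd_simp//; last first.
  exact: (@locally_integrable_itv _ _ _ a q).
rewrite Rintegral_itv_obnd_cbnd//.
by apply: (@locally_integrable_itv _ _ _ a q) => //; apply: subset_itv; rewrite bnd_simp.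
Qed.

Lemma ray_interval_nbhs a I p q : ray_interval a I -> I p -> I q -> p <= q ->
  exists2 d, 0 < d & `[p - d, q + d] `<=` I.
Proof.
move=> [oI _ Ia Ir] Ip Iq pq.
have ap : a < p by have := Ia p Ip; rewrite /= in_itv/= andbT.
have /nbhs_ballP[r /= r0 rI] : nbhs q I by exact: open_nbhs_nbhs.
(* The first bound keeps q + d in the open set I, the second keeps p - d to the right of a;
   everything between is then in I. *)
exists (Num.min (r / 2) ((p - a) / 2)).
  by rewrite lt_min; apply/andP; split; lra.
set d := Num.min _ _.
have dr : d <= r / 2 by rewrite ge_min lexx.
have da : d <= (p - a) / 2 by rewrite ge_min lexx orbT.
have d0 : 0 < d by rewrite lt_min; apply/andP; split; lra.
have Iqd : I (q + d).
  by apply: rI; rewrite /ball/= opprD addrA subrr sub0r normrN gtr0_norm//; lra.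
apply: subset_trans (Ir _ Iqd) => x /=; rewrite !in_itv/= => /andP[px ->].
by rewrite andbT; lra.
Qed.

Lemma restrict_le0 a I F : I `<=` `]a, +oo[ -> forall x, x <= a -> (F \_ I) x = 0.
Proof.
move=> Ia x xa; rewrite patchE; case: ifPn => // /set_mem/Ia/=.
by rewrite in_itv/= andbT ltNge xa.
Qed.

Lemma weak_derivative_primitive a I F G : ray_interval a I ->
  real_L2 I F -> real_L2 I G -> real_weak_derivative I F G ->
  exists2 U, primitive_of a (G \_ I) U & F = U %[ae mu in I].
Proof.
move=> rI /Lfun2_locally_integrable lF /Lfun2_locally_integrable lG FG.
have [oI I0 Ia Ir] := rI.
have aeL := ae_and (lebesgue_differentiation lF) (lebesgue_differentiation lG).
have [x0 Ix0 [Fx0 Gx0]] := ae_open_ex oI I0 aeL.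
have g0 := @restrict_le0 _ _ G Ia.
(* F minus the primitive of G has equal values at all common Lebesgue points of F and G; c is this
   value, read at one of them. *)
pose c := F x0 - \int[mu]_(t in `[a, x0]) (G \_ I) t.
have aI x : I x -> a <= x by move=> /Ia/=; rewrite in_itv/= andbT => /ltW.
exists (fun x => c + parameterized_integral mu a x (G \_ I)); first split.
- by move=> x; apply: cvgD; [exact: cvg_cst|exact: continuous_primitive].
- move=> x ax; rewrite /parameterized_integral.
  by rewrite [in X in _ = c + X + _]set_itv1 Rintegral_set1 addr0.
apply: (ae_imp aeL) => x [Fx Gx] Ix.
have FIE y : I y -> (F \_ I) y = F y by move=> Iy; rewrite patchE mem_set.
have incr p q : I p -> I q -> p <= q -> lebesgue_pt (F \_ I) p -> lebesgue_pt (F \_ I) q ->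
    lebesgue_pt (G \_ I) p -> lebesgue_pt (G \_ I) q ->
    F q - F p = \int[mu]_(t in `[a, q]) (G \_ I) t - \int[mu]_(t in `[a, p]) (G \_ I) t.
  move=> Ip Iq pq Fp Fq Gp Gq; have [d d0 dI] := ray_interval_nbhs rI Ip Iq pq.
  rewrite -(FIE _ Ip) -(FIE _ Iq) -(Rintegral_itv_diff lG (aI _ Ip) pq).
  exact: (real_weak_derivative_increment lF lG FG pq d0 dI).
rewrite /c /parameterized_integral.
case/orP: (le_total x x0) => xx.
  have := incr x x0 Ix Ix0 xx Fx Fx0 Gx Gx0.
  by move: (Rintegral _ _ _) (Rintegral _ _ _); clear; move=> A B; lra.
have := incr x0 x Ix0 Ix xx Fx0 Fx Gx0 Gx.
by move: (Rintegral _ _ _) (Rintegral _ _ _); clear; move=> A B; lra.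
Qed.

(** The primitives of G and G' are both a.e. equal to F, hence equal on I by continuity. So the
    integral of G - G' from a is constant on I, and its derivative at a Lebesgue point is both 0 and
    the value of G - G'. *)
Lemma weak_derivative_unique a I F G G' : ray_interval a I ->
  real_L2 I F -> real_L2 I G -> real_L2 I G' ->
  real_weak_derivative I F G -> real_weak_derivative I F G' ->
  G = G' %[ae mu in I].
Proof.
move=> rI F2 G2 G'2 FG FG'.
have [U [cU UE] FU] := weak_derivative_primitive rI F2 G2 FG.
have [U' [cU' U'E] FU'] := weak_derivative_primitive rI F2 G'2 FG'.
have [oI I0 Ia Ir] := rI.
have lG := Lfun2_locally_integrable G2; have lG' := Lfun2_locally_integrable G'2.
have UU' : {in closure I, U =1 U'}.
  apply: continuous_ae_eq => //; [exact: continuous_subspaceT|exact: continuous_subspaceT|].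
  by apply: (ae_imp (ae_and FU FU')) => x [H1 H2] Ix; rewrite -H1// -H2.
have lD := locally_integrableB lG lG'.
apply: (ae_imp (lebesgue_differentiation lD)) => x Dx Ix.
have ax : a < x by have := Ia x Ix; rewrite /= in_itv/= andbT.
have iI y (g : R -> R) : locally_integrable setT g -> mu.-integrable `[a, y] (EFin \o g).
  by move=> gl; exact: (@locally_integrable_itv _ _ _ a y).
have [_ ] := @FTC1_lebesgue_pt R _ (BLeft a) x (x + 1) (ltr_pwDr ltr01 (lexx x)) (iI _ _ lD) ax Dx.
rewrite derive1E (near_eq_derive (g := cst (U' a - U a))).
  rewrite derive_cst /= => /esym; rewrite !patchE mem_set// => /eqP.
  by rewrite subr_eq0 => /eqP.
have : nbhs x I by exact: open_nbhs_nbhs.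
apply: filterS => y Iy.
have ay : a <= y by have := Ia y Iy; rewrite /= in_itv/= andbT => /ltW.
rewrite RintegralB//; [|exact: iI|exact: iI].
have := UE y ay; have := U'E y ay.
rewrite UU'; last exact/mem_set/subset_closure.
by move: (Rintegral _ _ _) (Rintegral _ _ _); clear; move=> A B /=; lra.
Qed.

(** F''' F = (F'' F)' - F'' F', where F'' F' = (F'^2 / 2)' and F' F = (F^2 / 2)'. The product rule
    is applied to the pairs ([U2], [U0]), ([U1], [U1]) and ([U0], [U0]). *)
Lemma Rintegral_third_derivative a I F0 F1 F2 F3 U0 U1 U2 b : ray_interval a I ->
  real_L2 I F0 -> real_L2 I F1 -> real_L2 I F2 -> real_L2 I F3 ->
  primitive_of a (F1 \_ I) U0 -> primitive_of a (F2 \_ I) U1 -> primitive_of a (F3 \_ I) U2 ->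
  F0 = U0 %[ae mu in I] -> F1 = U1 %[ae mu in I] -> F2 = U2 %[ae mu in I] ->
  a <= b -> `]a, b[ `<=` I ->
  [/\ \int[mu]_(x in `[a, b]) ((F3 \_ I) x * (F0 \_ I) x) =
      U2 b * U0 b - U2 a * U0 a - 2^-1 * (U1 b ^+ 2 - U1 a ^+ 2) &
      \int[mu]_(x in `[a, b]) ((F1 \_ I) x * (F0 \_ I) x) = 2^-1 * (U0 b ^+ 2 - U0 a ^+ 2)].
Proof.
move=> rI /Lfun2_locally_integrable l0 /Lfun2_locally_integrable l1
  /Lfun2_locally_integrable l2 /Lfun2_locally_integrable l3
  [c0 E0] [c1 E1] [c2 E2] e0 e1 e2 ab abI.
have iI (g : R -> R) : locally_integrable setT g -> mu.-integrable `[a, b] (EFin \o g).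
  by move=> gl; exact: (@locally_integrable_itv _ _ _ a b).
(* I need not contain a and b, but two points are negligible. *)
have aeI F U : F = U %[ae mu in I] -> {ae mu, forall x, `[a, b]%classic x -> (F \_ I) x = U x}.
  move=> FU; apply: (ae_imp (ae_and FU (ae_and (ae_neq a) (ae_neq b)))) => x [H [xa xb]] /=.
  rewrite in_itv/= !le_eqVlt => /andP[/predU1P[ax|ax] /predU1P[bx|xb']]; [congruence..|].
  have Ix : I x by apply: abI; rewrite /= in_itv/= ax xb'.
  by rewrite patchE mem_set// H.
have mU U : continuous U -> measurable_fun setT U by exact: continuous_measurable_fun.
have mL F : locally_integrable setT (F \_ I) -> measurable_fun setT (F \_ I) by case.
have eqR (f g f' g' : R -> R) : measurable_fun setT f -> measurable_fun setT g ->
    measurable_fun setT f' -> measurable_fun setT g' ->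
    {ae mu, forall x, `[a, b]%classic x -> f x * g x = f' x * g' x} ->
    \int[mu]_(x in `[a, b]) (f x * g x) = \int[mu]_(x in `[a, b]) (f' x * g' x).
  move=> mf mg mf' mg' fg; apply: ae_eq_Rintegral => //.
    exact/measurable_funTS/measurable_funM.
  exact/measurable_funTS/measurable_funM.
have EE (g : R -> R) U : (forall x, a <= x -> U x = U a + \int[mu]_(t in `[a, x]) g t) ->
  forall x, a <= x <= b -> U x = U a + \int[mu]_(t in `[a, x]) g t.
  by move=> H x /andP[ax _]; exact: H.
have P20 := Rintegral_product ab (iI _ l3) (iI _ l1) (EE _ _ E2) (EE _ _ E0).
have P11 := Rintegral_product ab (iI _ l2) (iI _ l2) (EE _ _ E1) (EE _ _ E1).
have P00 := Rintegral_product ab (iI _ l1) (iI _ l1) (EE _ _ E0) (EE _ _ E0).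
have E30 : \int[mu]_(x in `[a, b]) ((F3 \_ I) x * (F0 \_ I) x) =
    \int[mu]_(x in `[a, b]) ((F3 \_ I) x * U0 x).
  by apply: eqR; auto; apply: (ae_imp (aeI _ _ e0)) => x H xab; rewrite H.
have E10 : \int[mu]_(x in `[a, b]) ((F1 \_ I) x * (F0 \_ I) x) =
    \int[mu]_(x in `[a, b]) ((F1 \_ I) x * U0 x).
  by apply: eqR; auto; apply: (ae_imp (aeI _ _ e0)) => x H xab; rewrite H.
(* Both integrands are a.e. F' F'', which links the product rule for ([U2], [U0]) to that for ([U1],
   [U1]). *)
have E12 : \int[mu]_(x in `[a, b]) ((F1 \_ I) x * U2 x) =
    \int[mu]_(x in `[a, b]) ((F2 \_ I) x * U1 x).
  apply: eqR; auto; apply: (ae_imp (ae_and (aeI _ _ e1) (aeI _ _ e2))) => x [H1 H2] xab.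
  by rewrite H1// H2// mulrC.
move: P20 P11 P00; rewrite E30 E10 E12.
move: (Rintegral _ _ _) (Rintegral _ _ _) (Rintegral _ _ _); clear; move=> A B C.
by move=> ? ? ?; split; lra.
Qed.

End Representative.

(** * Sobolev spaces of complex functions *)

Section WeakDerivativeComplex.
Local Open Scope complex_scope.
Context {R : realType}.
Notation mu := (@lebesgue_measure R).
Implicit Types (f g h : R -> R[i]) (F G : R -> R) (a b x : R) (I : set R).

Definition re f : R -> R := fun x => complex.Re (f x).
Definition im f : R -> R := fun x => complex.Im (f x).

Lemma ReMr (z : R[i]) (r : R) : complex.Re (z * r%:C) = complex.Re z * r.
Proof. by case: z => x y /=; rewrite mulr0 subr0. Qed.

Lemma ImMr (z : R[i]) (r : R) : complex.Im (z * r%:C) = complex.Im z * r.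
Proof. by case: z => x y /=; rewrite mulr0 add0r. Qed.

(** Test functions are real-valued, so real and imaginary parts decouple. *)
Lemma is_weak_derivativeP I f g : is_weak_derivative I f g <->
  real_weak_derivative I (re f) (re g) /\ real_weak_derivative I (im f) (im g).
Proof.
have RE (u : R -> R[i]) (w : R -> R) : cintegral I (fun x => u x * (w x)%:C) =
    (\int[mu]_(x in I) (re u x * w x)) +i* (\int[mu]_(x in I) (im u x * w x)).
  rewrite /cintegral; congr (_ +i* _); apply: eq_Rintegral => x _.
    by rewrite ReMr.
  by rewrite ImMr.
split=> [fg|[rfg ifg] w wI].
  by split=> w wI; have := fg w wI; rewrite !RE => -[].
by rewrite !RE (rfg w wI) (ifg w wI).
Qed.

Lemma real_L2_measurable I F : measurable (I : set (measurableTypeR R)) ->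
  real_L2 I F -> measurable_fun I F.
Proof.
move=> mI /sub_Lfun_mfun; rewrite inE => mF; exact/(measurable_restrictT _ _).2.
Qed.

Lemma real_weak_derivative_ae I F F' G : open I -> real_L2 I F -> real_L2 I F' ->
  F = F' %[ae mu in I] -> real_weak_derivative I F G -> real_weak_derivative I F' G.
Proof.
move=> oI F2 F'2 FF' FG w wI; rewrite -FG//.
have mI := open_measurable oI.
have mw : measurable_fun I (derive1 w).
  have [_ cw _] := wI; apply: measurable_funTS; exact: continuous_measurable_fun cw.
apply: ae_eq_Rintegral => //.
- by apply: measurable_funM => //; exact: real_L2_measurable.
- by apply: measurable_funM => //; exact: real_L2_measurable.
- by apply: (ae_imp FF') => x H Ix; rewrite H.
Qed.

Lemma re_im_ae I f g : f = g %[ae mu in I] <->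
  re f = re g %[ae mu in I] /\ im f = im g %[ae mu in I].
Proof.
split=> [fg|[rfg ifg]].
  by split; apply: (ae_imp fg) => x H Ix; rewrite /re /im H.
apply: (ae_imp (ae_and rfg ifg)) => x [H1 H2] Ix.
by move: (H1 Ix) (H2 Ix); rewrite /re /im; case: (f x) (g x) => ? ? [? ?] /= -> ->.
Qed.

Lemma is_weak_derivative_ae I f f' g : open I -> L2 I f -> L2 I f' ->
  f = f' %[ae mu in I] -> is_weak_derivative I f g -> is_weak_derivative I f' g.
Proof.
move=> oI [rf imf] [rf' imf'] /re_im_ae[rff' iff'] /is_weak_derivativeP[H1 H2].
apply/is_weak_derivativeP; split.
  exact: real_weak_derivative_ae H1.
exact: real_weak_derivative_ae H2.
Qed.

Lemma is_weak_derivative_unique a I f g g' : ray_interval a I ->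
  L2 I f -> L2 I g -> L2 I g' ->
  is_weak_derivative I f g -> is_weak_derivative I f g' -> g = g' %[ae mu in I].
Proof.
move=> rI [rf imf] [rg img] [rg' img'] /is_weak_derivativeP[H1 H2] /is_weak_derivativeP[H3 H4].
apply/re_im_ae; split.
  exact: weak_derivative_unique rI rf rg rg' H1 H3.
exact: weak_derivative_unique rI imf img img' H2 H4.
Qed.

Lemma sobolev_L2 m I f : sobolev m I f -> L2 I f.
Proof. by case: m => [//|m] []. Qed.

Lemma sobolev_ae m I f g : open I -> L2 I g -> f = g %[ae mu in I] ->
  sobolev m I f -> sobolev m I g.
Proof.
move=> oI g2 fg; case: m => [//|m] [f2 [h [fh hm]]]; split => //.
by exists h; split => //; exact: is_weak_derivative_ae fh.
Qed.

(* [wderiv] is an arbitrary choice of weak derivative: a.e. uniqueness transfers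
   to it the regularity of the witness given by [sobolev]. *)
Lemma sobolev_wderiv m a I f : ray_interval a I -> sobolev m.+1 I f ->
  [/\ L2 I f, sobolev m I (wderiv I f) & is_weak_derivative I f (wderiv I f)].
Proof.
move=> rI [f2 [g [fg gm]]].
have g2 := sobolev_L2 gm.
have [w2 fw] : L2 I (wderiv I f) /\ is_weak_derivative I f (wderiv I f).
  by apply: (@xgetPex _ (fun=> 0) [set g | L2 I g /\ is_weak_derivative I f g]); exists g.
split => //; apply: sobolev_ae gm => //; first by case: rI.
exact: is_weak_derivative_unique rI f2 g2 w2 fg fw.
Qed.

Lemma continuous_repP a I f g : ray_interval a I -> L2 I f -> L2 I g ->
  is_weak_derivative I f g ->
  exists U V, [/\ primitive_of a (re g \_ I) U /\ re f = U %[ae mu in I],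
    primitive_of a (im g \_ I) V /\ im f = V %[ae mu in I] &
    forall x, closure I x -> boundary_value I f x = U x +i* V x].
Proof.
move=> rI [rf imf] [rg img] /is_weak_derivativeP[H1 H2].
have [U PU FU] := weak_derivative_primitive rI rf rg H1.
have [V PV FV] := weak_derivative_primitive rI imf img H2.
exists U, V; split => // x Ix.
have oI : open I by case: rI.
have [c1 c2 /re_im_ae[e1 e2]] : [/\ {within closure I, continuous (re (continuous_rep I f))},
        {within closure I, continuous (im (continuous_rep I f))} &
        f = continuous_rep I f %[ae mu in I]].
  apply: (@xgetPex _ (fun=> 0) [set g |
    [/\ {within closure I, continuous (fun x => complex.Re (g x))},
        {within closure I, continuous (fun x => complex.Im (g x))} &
        f = g %[ae mu in I]]]).
  exists (fun x => U x +i* V x); split.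
  - by apply: continuous_subspaceT; case: PU.
  - by apply: continuous_subspaceT; case: PV.
  - exact/re_im_ae.
have EU : U x = complex.Re (continuous_rep I f x).
  apply: (continuous_ae_eq oI _ c1 _ (mem_set Ix)).
    by apply: continuous_subspaceT; case: PU.
  by apply: (ae_imp (ae_and FU e1)) => y [A B] Iy; rewrite -A// -B.
have EV : V x = complex.Im (continuous_rep I f x).
  apply: (continuous_ae_eq oI _ c2 _ (mem_set Ix)).
    by apply: continuous_subspaceT; case: PV.
  by apply: (ae_imp (ae_and FV e2)) => y [A B] Iy; rewrite -A// -B.
by rewrite EU EV /boundary_value; case: (continuous_rep I f x).
Qed.

Lemma ray_interval_loop L : 0 < L -> ray_interval (- L) (loop L : set R).
Proof.
move=> L0; split; rewrite /loop.
- exact: interval_open.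
- by exists 0; rewrite /= in_itv/= oppr_lt0 L0.
- by apply: subset_itvl; rewrite bnd_simp.
- move=> x /=; rewrite in_itv/= => /andP[_ xL] y /=; rewrite !in_itv/= => /andP[-> yx].
  exact: le_lt_trans yx xL.
Qed.

Lemma ray_interval_half_line L : ray_interval L (half_line L : set R).
Proof.
split; rewrite /half_line//.
- by exists (L + 1); rewrite /= in_itv/= andbT ltrDl.
- by move=> x _ y /=; rewrite !in_itv/= => /andP[->].
Qed.

Lemma closure_ray_interval a I : ray_interval a I -> closure I a.
Proof.
move=> [_ [y Iy] Ia Ir] B /nbhs_ballP[e /= e0 eB].
have ay : a < y by have := Ia y Iy; rewrite /= in_itv/= andbT.
pose d := Num.min (e / 2) (y - a).
have d0 : 0 < d by rewrite lt_min divr_gt0//= subr_gt0.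
exists (a + d); split.
  apply: (Ir y Iy); rewrite /= in_itv/= ltrDl d0/= -lerBrDl.
  by rewrite ge_min lexx orbT.
apply: eB; rewrite /ball/= opprD addrA subrr sub0r normrN gtr0_norm//.
by rewrite gt_min ltr_pdivrMr// mulr_natr mulr2n ltrDl e0.
Qed.

Lemma closure_loop_right L : 0 < L -> closure (loop L : set R) L.
Proof.
move=> L0 B /nbhs_ballP[e /= e0 eB].
pose d := Num.min (e / 2) L.
have d0 : 0 < d by rewrite lt_min divr_gt0.
have dL : d <= L by rewrite ge_min lexx orbT.
exists (L - d); split.
  by rewrite /loop/= in_itv/=; apply/andP; split; lra.
apply: eB; rewrite /ball/= opprB addrC subrK gtr0_norm//.
by rewrite gt_min ltr_pdivrMr// mulr_natr mulr2n ltrDl e0.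
Qed.

End WeakDerivativeComplex.

(** * Skewness of the generator *)

Section Skewness.
Context {R : realType}.
Local Open Scope complex_scope.
Notation mu := (@lebesgue_measure R).
Implicit Types (f g h : R -> R[i]) (F G U : R -> R) (a b x L : R) (I : set R).

Definition real_inner I F G : R := \int[mu]_x ((F \_ I) x * (G \_ I) x).

Lemma integrable_inner I F G : real_L2 I F -> real_L2 I G ->
  mu.-integrable setT (EFin \o (fun x => (F \_ I) x * (G \_ I) x)).
Proof. by move=> F2 G2; apply/Lfun1_integrable; exact: Lfun2_mul_Lfun1. Qed.

Lemma eq_ae_integrable I F G : measurable (I : set (measurableTypeR R)) ->
  mu.-integrable I (EFin \o F) -> measurable_fun I G ->
  F = G %[ae mu in I] -> mu.-integrable I (EFin \o G).
Proof.
move=> mI Fi mG FG; apply/integrableP; split; first exact/measurable_EFinP.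
have mF : measurable_fun I F by apply/measurable_EFinP; exact: measurable_int Fi.
have /integrableP[_] := Fi; apply: le_lt_trans.
rewrite le_eqVlt; apply/orP; left; apply/eqP; apply: ge0_ae_eq_integral => //.
- by do 2 apply: measurableT_comp => //.
- by do 2 apply: measurableT_comp => //.
- exact: (ae_imp (Q := fun x => I x -> (`|(G x)%:E|)%E = (`|(F x)%:E|)%E) FG
    (fun x H Ix => congr1 (fun y => (`|y%:E|)%E) (esym (H Ix)))).
Qed.

Lemma loop_skew L F0 F1 F2 F3 U0 U1 U2 : 0 < L ->
  real_L2 (loop L) F0 -> real_L2 (loop L) F1 ->
  real_L2 (loop L) F2 -> real_L2 (loop L) F3 ->
  primitive_of (- L) (F1 \_ (loop L)) U0 -> primitive_of (- L) (F2 \_ (loop L)) U1 ->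
  primitive_of (- L) (F3 \_ (loop L)) U2 ->
  F0 = U0 %[ae mu in loop L] -> F1 = U1 %[ae mu in loop L] ->
  F2 = U2 %[ae mu in loop L] ->
  U0 (- L) = U0 L -> U1 (- L) = U1 L -> U2 (- L) = U2 L ->
  real_inner (loop L) F3 F0 = 0 /\ real_inner (loop L) F1 F0 = 0.
Proof.
move=> L0 l0 l1 l2 l3 P0 P1 P2 e0 e1 e2 b0 b1 b2.
have LL : - L <= L by lra.
have [E3 E1] := Rintegral_third_derivative (b := L) (ray_interval_loop L0) l0 l1 l2 l3
  P0 P1 P2 e0 e1 e2 LL (fun x H => H).
have supp F : real_inner (loop L) F F0 =
    \int[mu]_(x in `[- L, L]) ((F \_ (loop L)) x * (F0 \_ (loop L)) x).
  apply: Rintegral_supp => x nx; rewrite patchE; case: ifPn; rewrite ?mul0r//.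
  by move=> /set_mem xL; exfalso; apply: nx; exact: subset_itv_oo_cc xL.
by rewrite !supp E3 E1 b0 b1 b2 !subrr mulr0 subr0.
Qed.

Lemma half_line_skew L F0 F1 F2 F3 U0 U1 U2 :
  real_L2 (half_line L) F0 -> real_L2 (half_line L) F1 ->
  real_L2 (half_line L) F2 -> real_L2 (half_line L) F3 ->
  primitive_of L (F1 \_ (half_line L)) U0 -> primitive_of L (F2 \_ (half_line L)) U1 ->
  primitive_of L (F3 \_ (half_line L)) U2 ->
  F0 = U0 %[ae mu in half_line L] -> F1 = U1 %[ae mu in half_line L] ->
  F2 = U2 %[ae mu in half_line L] ->
  U0 L = 0 -> U1 L = 0 ->
  real_inner (half_line L) F3 F0 = 0 /\ real_inner (half_line L) F1 F0 = 0.
Proof.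
move=> l0 l1 l2 l3 P0 P1 P2 e0 e1 e2 b0 b1.
have rI := ray_interval_half_line L.
have E b := Rintegral_third_derivative (b := b) rI l0 l1 l2 l3 P0 P1 P2 e0 e1 e2.
have IbE b : `]L, b[ `<=` half_line L by apply: subset_itvl; rewrite bnd_simp.
have vanish F x : x <= L -> (F \_ (half_line L)) x * (F0 \_ (half_line L)) x = 0.
  have [_ _ IL _] := rI.
  by move=> xL; rewrite (restrict_le0 F IL)// mul0r.
have mU U F : primitive_of L F U -> measurable_fun setT U.
  by move=> [cU _]; exact: continuous_measurable_fun.
have aeI F U : F = U %[ae mu in half_line L] ->
    {ae mu, forall x, `[L, +oo[%classic x -> (F \_ (half_line L)) x = U x}.
  move=> FU; apply: (ae_imp (ae_and FU (ae_neq L))) => x [H xL] /=.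
  rewrite in_itv/= andbT le_eqVlt => /predU1P[Lx|Lx]; first by rewrite Lx in xL.
  have Ix : half_line L x by rewrite /half_line/= in_itv/= Lx.
  by rewrite patchE mem_set// H.
have iL F G : real_L2 (half_line L) F -> real_L2 (half_line L) G ->
    mu.-integrable `[L, +oo[ (EFin \o (fun x => (F \_ (half_line L)) x * (G \_ (half_line L)) x)).
  by move=> F2' G2; apply: (@integrableS _ _ _ mu setT) (integrable_inner F2' G2).
(* The boundary expressions are built from products of primitives; each product is a.e. a product of
   two L^2 functions, hence integrable up to infinity. *)
have iU F G U V : real_L2 (half_line L) F -> real_L2 (half_line L) G ->
    measurable_fun setT U -> measurable_fun setT V ->
    F = U %[ae mu in half_line L] -> G = V %[ae mu in half_line L] ->
    mu.-integrable `[L, +oo[ (EFin \o (fun x => U x * V x)).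
  move=> F2' G2 mU' mV FU GV; apply: (eq_ae_integrable _ (iL _ _ F2' G2)) => //.
    exact/measurable_funTS/measurable_funM.
  by apply: (ae_imp (ae_and (aeI _ _ FU) (aeI _ _ GV))) => x [H1 H2] Lx; rewrite H1// H2.
have m0 := mU _ _ P0; have m1 := mU _ _ P1; have m2 := mU _ _ P2.
split.
- apply: (Rintegral_ray_eq0 (a := L) (U := fun x => U2 x * U0 x - 2^-1 * (U1 x * U1 x))).
  + exact: integrable_inner.
  + exact: vanish.
  + apply: integrable_subr => //; first exact: (iU F2 F0).
    by apply: integrable_mulrl => //; exact: (iU F1 F1).
  + move=> x Lx; have [-> _] := E x Lx (IbE x).
    (* [U0 L = 0] removes the product with [U2 L], and [U1 L = 0] removes the square. *)
    by rewrite b0 b1 mulr0 expr0n/= !subr0 expr2.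
- apply: (Rintegral_ray_eq0 (a := L) (U := fun x => 2^-1 * (U0 x * U0 x))).
  + exact: integrable_inner.
  + exact: vanish.
  + by apply: integrable_mulrl => //; exact: (iU F0 F0).
  + move=> x Lx; have [_ ->] := E x Lx (IbE x).
    by rewrite b0 expr0n/= !subr0 expr2.
Qed.

(** The real part of the Hermitian inner product of L^2(I). *)
Definition inner I f g : R := real_inner I (re f) (re g) + real_inner I (im f) (im g).

Lemma sobolev3_wderivn a I f : ray_interval a I -> sobolev 3 I f ->
  (forall k, (k <= 3)%N -> L2 I (wderivn k I f)) /\
  (forall k, (k < 3)%N -> is_weak_derivative I (wderivn k I f) (wderivn k.+1 I f)).
Proof.
move=> rI s3.
have [L0 s2 w0] := sobolev_wderiv rI s3.
have [L1 s1 w1] := sobolev_wderiv rI s2.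
have [L2' L3 w2] := sobolev_wderiv rI s1.
split; [case=> [|[|[|[|k kn]]]]|case=> [|[|[|k kn]]]]; last by move: kn; clear.
- by move=> _; exact: L0.
- by move=> _; exact: L1.
- by move=> _; exact: L2'.
- by move=> _; exact: L3.
- by move: kn; clear.
- by move=> _; exact: w0.
- by move=> _; exact: w1.
- by move=> _; exact: w2.
Qed.

Lemma inner_loop L f : 0 < L -> sobolev 3 (loop L) f ->
  (forall k, (k < 3)%N -> boundary_value (loop L) (wderivn k (loop L) f) (- L) =
     boundary_value (loop L) (wderivn k (loop L) f) L) ->
  inner (loop L) (wderivn 3 (loop L) f) f = 0 /\
  inner (loop L) (wderivn 1 (loop L) f) f = 0.
Proof.
move=> L0 s3 bv; have rI := ray_interval_loop L0.
have [l2 wd] := sobolev3_wderivn rI s3.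
have cL := closure_ray_interval rI; have cR := closure_loop_right L0.
have [U0 [V0 [[PU0 eU0] [PV0 eV0] B0]]] :=
  continuous_repP rI (l2 0%N isT) (l2 1%N isT) (wd 0%N isT).
have [U1 [V1 [[PU1 eU1] [PV1 eV1] B1]]] :=
  continuous_repP rI (l2 1%N isT) (l2 2%N isT) (wd 1%N isT).
have [U2 [V2 [[PU2 eU2] [PV2 eV2] B2]]] :=
  continuous_repP rI (l2 2%N isT) (l2 3%N isT) (wd 2%N isT).
have [u0 v0] : U0 (- L) = U0 L /\ V0 (- L) = V0 L.
  by have := bv 0%N isT; rewrite (B0 _ cL) (B0 _ cR) => -[].
have [u1 v1] : U1 (- L) = U1 L /\ V1 (- L) = V1 L.
  by have := bv 1%N isT; rewrite (B1 _ cL) (B1 _ cR) => -[].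
have [u2 v2] : U2 (- L) = U2 L /\ V2 (- L) = V2 L.
  by have := bv 2%N isT; rewrite (B2 _ cL) (B2 _ cR) => -[].
have [r0 i0] := l2 0%N isT; have [r1 i1] := l2 1%N isT.
have [r2 i2] := l2 2%N isT; have [r3 i3] := l2 3%N isT.
have [R3 R1] := loop_skew L0 r0 r1 r2 r3 PU0 PU1 PU2 eU0 eU1 eU2 u0 u1 u2.
have [I3 I1] := loop_skew L0 i0 i1 i2 i3 PV0 PV1 PV2 eV0 eV1 eV2 v0 v1 v2.
split.
  exact: (etrans (congr2 +%R R3 I3) (addr0 _)).
exact: (etrans (congr2 +%R R1 I1) (addr0 _)).
Qed.

Lemma inner_half_line L f : sobolev 3 (half_line L) f ->
  (forall k, (k < 2)%N -> boundary_value (half_line L) (wderivn k (half_line L) f) L = 0) ->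
  inner (half_line L) (wderivn 3 (half_line L) f) f = 0 /\
  inner (half_line L) (wderivn 1 (half_line L) f) f = 0.
Proof.
move=> s3 bv; have rI := ray_interval_half_line L.
have [l2 wd] := sobolev3_wderivn rI s3.
have cL := closure_ray_interval rI.
have [U0 [V0 [[PU0 eU0] [PV0 eV0] B0]]] :=
  continuous_repP rI (l2 0%N isT) (l2 1%N isT) (wd 0%N isT).
have [U1 [V1 [[PU1 eU1] [PV1 eV1] B1]]] :=
  continuous_repP rI (l2 1%N isT) (l2 2%N isT) (wd 1%N isT).
have [U2 [V2 [[PU2 eU2] [PV2 eV2] B2]]] :=
  continuous_repP rI (l2 2%N isT) (l2 3%N isT) (wd 2%N isT).
have [u0 v0] : U0 L = 0 /\ V0 L = 0.
  by have := bv 0%N isT; rewrite (B0 _ cL) => -[].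
have [u1 v1] : U1 L = 0 /\ V1 L = 0.
  by have := bv 1%N isT; rewrite (B1 _ cL) => -[].
have [r0 i0] := l2 0%N isT; have [r1 i1] := l2 1%N isT.
have [r2 i2] := l2 2%N isT; have [r3 i3] := l2 3%N isT.
have [R3 R1] := half_line_skew r0 r1 r2 r3 PU0 PU1 PU2 eU0 eU1 eU2 u0 u1.
have [I3 I1] := half_line_skew i0 i1 i2 i3 PV0 PV1 PV2 eV0 eV1 eV2 v0 v1.
split.
  exact: (etrans (congr2 +%R R3 I3) (addr0 _)).
exact: (etrans (congr2 +%R R1 I1) (addr0 _)).
Qed.

End Skewness.

(** * The real inner product of L^2(G) *)

Section GraphInnerProduct.
Context {R : realType}.
Local Open Scope complex_scope.
Notation mu := (@lebesgue_measure R).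
Implicit Types (f g h : R -> R[i]) (F G H : R -> R) (c d L : R) (I : set R).
Implicit Types (V W Z : graph_fun R).

Lemma restrict_lin I c d F G x :
  ((fun x => c * F x + d * G x) \_ I) x = c * (F \_ I) x + d * (G \_ I) x.
Proof. by rewrite !patchE; case: ifP => // _; rewrite !mulr0 addr0. Qed.

Lemma real_L2_lin I c d F G : real_L2 I F -> real_L2 I G ->
  real_L2 I (fun x => c * F x + d * G x).
Proof.
move=> F2 G2; rewrite /real_L2.
(* The closure property concerns c u + v with v already in the space; the added 0 lets it be applied
   twice. *)
have -> : (fun x => c * F x + d * G x) \_ I = c *: (F \_ I) + (d *: (G \_ I) + 0).
  by apply/funext => x; rewrite restrict_lin addr0.
have [L0 LD] := @Lfun_submod_closed _ _ R mu 2%:E (lee1n 2).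
by apply: (LD c) => //; exact: (LD d).
Qed.

Lemma real_innerC I F G : real_inner I F G = real_inner I G F.
Proof. by apply: eq_Rintegral => x _; rewrite mulrC. Qed.

Lemma real_inner_lin I c d F G H : real_L2 I F -> real_L2 I G -> real_L2 I H ->
  real_inner I (fun x => c * F x + d * G x) H = c * real_inner I F H + d * real_inner I G H.
Proof.
move=> F2 G2 H2; have iF := integrable_inner F2 H2; have iG := integrable_inner G2 H2.
rewrite /real_inner -!RintegralZl// -RintegralD//;
  [|exact: integrable_mulrl|exact: integrable_mulrl].
by apply: eq_Rintegral => x _; rewrite restrict_lin mulrDl !mulrA.
Qed.

Lemma real_inner_ge0 I F : 0 <= real_inner I F F.
Proof. by apply: Rintegral_ge0 => x _; rewrite -expr2 sqr_ge0. Qed.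

Lemma real_inner_ae I F G H : open I -> real_L2 I F -> real_L2 I G -> real_L2 I H ->
  F = G %[ae mu in I] -> real_inner I F H = real_inner I G H.
Proof.
have mL2 K : real_L2 I K -> measurable_fun setT (K \_ I).
  by move=> /sub_Lfun_mfun; rewrite inE.
move=> oI F2 G2 H2 FG; apply: ae_eq_Rintegral => //.
- by apply: measurable_funM; exact: mL2.
- by apply: measurable_funM; exact: mL2.
- apply: (ae_imp FG) => x E _; rewrite !patchE; case: ifPn => // xI.
  by rewrite E//; exact/set_mem.
Qed.

Definition lin_fun c d f g : R -> R[i] := fun x => c%:C * f x + d%:C * g x.

Lemma re_lin c d f g : re (lin_fun c d f g) = fun x => c * re f x + d * re g x.
Proof.
apply/funext => x; rewrite /re /lin_fun.
by case: (f x) (g x) => ? ? [? ?] /=; rewrite !mul0r !subr0.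
Qed.

Lemma im_lin c d f g : im (lin_fun c d f g) = fun x => c * im f x + d * im g x.
Proof.
apply/funext => x; rewrite /im /lin_fun.
by case: (f x) (g x) => ? ? [? ?] /=; rewrite !mul0r !addr0.
Qed.

Lemma L2_lin I c d f g : L2 I f -> L2 I g -> L2 I (lin_fun c d f g).
Proof.
move=> [rf imf] [rg img]; split.
  by have := real_L2_lin c d rf rg; rewrite -re_lin.
by have := real_L2_lin c d imf img; rewrite -im_lin.
Qed.

Lemma inner_lin I c d f g h : L2 I f -> L2 I g -> L2 I h ->
  inner I (lin_fun c d f g) h = c * inner I f h + d * inner I g h.
Proof.
move=> [rf imf] [rg img] [rh imh]; rewrite /inner re_lin im_lin !real_inner_lin//.
by rewrite !mulrDr addrACA.
Qed.

Lemma innerC I f g : inner I f g = inner I g f.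
Proof. by rewrite /inner real_innerC [X in _ + X]real_innerC. Qed.

Lemma inner_ae I f g h : open I -> L2 I f -> L2 I g -> L2 I h ->
  f = g %[ae mu in I] -> inner I f h = inner I g h.
Proof.
move=> oI [rf imf] [rg img] [rh imh] /re_im_ae[rfg ifg].
by rewrite /inner (real_inner_ae oI rf rg rh rfg) (real_inner_ae oI imf img imh ifg).
Qed.

Lemma L2normsqE I f : L2 I f -> L2normsq I f = inner I f f.
Proof.
move=> [rf imf]; rewrite /inner /real_inner -RintegralD//;
  [|exact: integrable_inner|exact: integrable_inner].
rewrite /L2normsq Rintegral_mkcond; apply: eq_Rintegral => x _; rewrite !patchE.
case: ifP => _; last by rewrite mulr0 addr0.
rewrite /re /im /Normc.normc; case: (f x) => u v /=.
by rewrite sqr_sqrtr ?addr_ge0 ?sqr_ge0// !expr2.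
Qed.

Definition graph_inner L V W : R :=
  inner (loop L) V.1 W.1 + inner (half_line L) V.2 W.2.

Lemma graph_innerC L V W : graph_inner L V W = graph_inner L W V.
Proof. by rewrite /graph_inner innerC [X in _ + X]innerC. Qed.

Lemma graph_inner_ge0 L V : 0 <= graph_inner L V V.
Proof. by rewrite /graph_inner /inner !addr_ge0// real_inner_ge0. Qed.

Lemma graph_L2_lin L c d V W : graph_L2 L V -> graph_L2 L W ->
  graph_L2 L (graph_lin c d V W).
Proof. by move=> [V1 V2] [W1 W2]; split; exact: L2_lin. Qed.

Lemma graph_inner_lin L c d V W Z : graph_L2 L V -> graph_L2 L W -> graph_L2 L Z ->
  graph_inner L (graph_lin c d V W) Z = c * graph_inner L V Z + d * graph_inner L W Z.
Proof.
move=> [V1 V2] [W1 W2] [Z1 Z2]; rewrite /graph_inner.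
have -> := inner_lin c d V1 W1 Z1; have -> := inner_lin c d V2 W2 Z2.
by rewrite !mulrDr addrACA.
Qed.

Lemma graph_normE L V : graph_L2 L V -> graph_norm L V = Num.sqrt (graph_inner L V V).
Proof. by move=> [V1 V2]; rewrite /graph_norm (L2normsqE V1) (L2normsqE V2). Qed.

Lemma graph_norm_sqr L V : graph_L2 L V -> graph_norm L V ^+ 2 = graph_inner L V V.
Proof. by move=> V2; rewrite graph_normE// sqr_sqrtr// graph_inner_ge0. Qed.

Lemma graph_inner_eq L V W Z : graph_L2 L V -> graph_L2 L W -> graph_L2 L Z ->
  graph_eq L V W -> graph_inner L V Z = graph_inner L W Z.
Proof.
move=> [V1 V2] [W1 W2] [Z1 Z2] [E1 E2]; rewrite /graph_inner.
by rewrite (inner_ae _ V1 W1 Z1 E1) ?(inner_ae _ V2 W2 Z2 E2).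
Qed.

Lemma graph_inner_CS L V W : graph_L2 L V -> graph_L2 L W ->
  `|graph_inner L V W| <= graph_norm L V * graph_norm L W.
Proof.
move=> V2 W2; rewrite graph_normE// graph_normE// -sqrtrM ?graph_inner_ge0//.
rewrite -sqrtr_sqr ler_wsqrtr//.
set a := graph_inner L V V; set b := graph_inner L V W; set c := graph_inner L W W.
have a0 : 0 <= a := graph_inner_ge0 L V; have c0 : 0 <= c := graph_inner_ge0 L W.
have Q x y : 0 <= x ^+ 2 * a + 2 * x * y * b + y ^+ 2 * c.
  have := graph_inner_ge0 L (graph_lin x y V W).
  have VW2 := graph_L2_lin x y V2 W2.
  rewrite graph_inner_lin// graph_innerC graph_inner_lin//.
  rewrite [graph_inner L W (graph_lin _ _ _ _)]graph_innerC graph_inner_lin//.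
  by rewrite (graph_innerC L W V) -/a -/b -/c; congr (0 <= _); ring.
(* At (c, -b) the quadratic form equals c (a c - b^2), which settles the case c > 0. *)
have := Q c (- b); have := Q b (- a).
move: Q; clearbody a b c; clear -a0 c0 => Q.
have [c_gt0|] := ltP 0 c.
  move=> _ H; have : 0 <= c * (a * c - b ^+ 2) by move: H; nra.
  by rewrite pmulr_rge0// subr_ge0.
move=> c_le0; have c_eq0 : c = 0 by apply/eqP; rewrite eq_le c_le0 c0.
move=> _ _; move: Q; rewrite c_eq0 mulr0 => Q.
(* With c = 0 the form at this point is -(a + 2) b^2, which forces b = 0 even when a = 0. *)
have := Q b (- (a + 1)) => H.
by have : 0 <= b ^+ 2 * a; [rewrite mulr_ge0 ?sqr_ge0|move: H; nra].
Qed.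

End GraphInnerProduct.

(** * Decay of the energy *)

Section EnergyDecay.
Context {R : realType}.
Implicit Types (L alpha beta gamma t : R) (V W P : graph_fun R) (U : R -> graph_fun R).

Lemma A_dom_graph_L2 L V : A_dom L V -> graph_L2 L V.
Proof. by move=> [V1 V2 _ _]; split; [exact: sobolev_L2 V1|exact: sobolev_L2 V2]. Qed.

Lemma A_op_graph_L2 L alpha beta V : 0 < L -> A_dom L V -> graph_L2 L (A_op L alpha beta V).
Proof.
move=> L0 [V1 V2 _ _].
have [l1 _] := sobolev3_wderivn (ray_interval_loop L0) V1.
have [l2 _] := sobolev3_wderivn (ray_interval_half_line L) V2.
by apply: graph_L2_lin; split; [exact: l1 3%N _|exact: l2 3%N _|exact: l1 1%N _|exact: l2 1%N _].
Qed.

Lemma A_op_skew L alpha beta V : 0 < L -> A_dom L V ->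
  graph_inner L (A_op L alpha beta V) V = 0.
Proof.
move=> L0 dV; have [V1 V2 b1 b2] := dV.
have [l1 _] := sobolev3_wderivn (ray_interval_loop L0) V1.
have [l2 _] := sobolev3_wderivn (ray_interval_half_line L) V2.
have [a3 a1] := inner_loop L0 V1 b1; have [c3 c1] := inner_half_line V2 b2.
have W3 : graph_L2 L (wderivn 3 (loop L) V.1, wderivn 3 (half_line L) V.2).
  by split; [exact: l1 3%N _|exact: l2 3%N _].
have W1 : graph_L2 L (wderivn 1 (loop L) V.1, wderivn 1 (half_line L) V.2).
  by split; [exact: l1 1%N _|exact: l2 1%N _].
rewrite /A_op (graph_inner_lin alpha beta W3 W1 (A_dom_graph_L2 dV)) /graph_inner/=.
by move: a3 a1 c3 c1 => /= -> -> -> ->; rewrite !addr0 !mulr0 addr0.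
Qed.

Lemma graph_norm_ge0 L V : 0 <= graph_norm L V.
Proof. exact: sqrtr_ge0. Qed.

(** For V = U(s), W = U(t), P = U'(t) and d = s - t, E is the error of the difference quotient, so V
    = W + d (P + E); the identity expands |V|^2 accordingly. *)
Lemma graph_inner_quotient L d V W P : graph_L2 L V -> graph_L2 L W -> graph_L2 L P ->
  d != 0 ->
  let E := graph_sub (graph_lin d^-1 (- d^-1) V W) P in
  d^-1 * (graph_inner L V V - graph_inner L W W) =
  2 * graph_inner L P W + 2 * graph_inner L E W +
  d * (graph_inner L E E + 2 * graph_inner L E P + graph_inner L P P).
Proof.
move=> V2 W2 P2 d0 E.
have D2 := graph_L2_lin d^-1 (- d^-1) V2 W2.
have E2 : graph_L2 L E by exact: graph_L2_lin.
have EX X : graph_L2 L X -> graph_inner L E X =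
    d^-1 * graph_inner L V X - d^-1 * graph_inner L W X - graph_inner L P X.
  move=> X2; rewrite /E /graph_sub graph_inner_lin// graph_inner_lin// mul1r mulN1r.
  by rewrite mulNr.
rewrite (EX E E2) (EX W W2) (EX P P2).
rewrite (graph_innerC L V E) (graph_innerC L W E) (graph_innerC L P E).
rewrite (EX V V2) (EX W W2) (EX P P2).
rewrite (graph_innerC L P V) (graph_innerC L P W) (graph_innerC L W V).
by field.
Qed.

(** By Cauchy-Schwarz, with e the norm of the error and |P + E|^2 at most (e + |P|)^2. The bound
    tends to 0 with e and d. *)
Lemma graph_inner_quotient_le L d V W P e : graph_L2 L V -> graph_L2 L W -> graph_L2 L P ->
  d != 0 -> e = graph_norm L (graph_sub (graph_lin d^-1 (- d^-1) V W) P) ->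
  `|2 * graph_inner L P W - d^-1 * (graph_inner L V V - graph_inner L W W)| <=
  2 * (e * graph_norm L W) + `|d| * ((e + graph_norm L P) * (e + graph_norm L P)).
Proof.
move=> V2 W2 P2 d0; rewrite (graph_inner_quotient V2 W2 P2 d0).
set E := graph_sub _ _ => eE.
have E2 : graph_L2 L E by apply: graph_L2_lin => //; exact: graph_L2_lin.
have EW := graph_inner_CS E2 W2; have EP := graph_inner_CS E2 P2.
rewrite -(graph_norm_sqr E2) -(graph_norm_sqr P2) -!eE in EW EP *.
rewrite -addrA opprD addrA subrr add0r normrN.
apply: le_trans (ler_normD _ _) _; rewrite !normrM lerD//.
  by rewrite ger0_norm// ler_wpM2l.
rewrite ler_wpM2l//.
move: EP (graph_norm_ge0 L P) (graph_norm_ge0 L E); rewrite -eE.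
move: (graph_inner L E P) (graph_norm L P) e {eE EW}; clear => b p e.
rewrite !ler_norml => /andP[? ?] ? ?.
by apply/andP; split; nra.
Qed.

Lemma L2_derivative_quotient_cvg L U (U' : R -> graph_fun R) t :
  (forall s, 0 <= s -> graph_L2 L (U s)) -> (forall s, 0 <= s -> graph_L2 L (U' s)) ->
  L2_derivative L U U' -> 0 <= t ->
  (s - t)^-1 * (graph_inner L (U s) (U s) - graph_inner L (U t) (U t))
    @[s --> within `[0, +oo[%classic (t^')] --> 2 * graph_inner L (U' t) (U t).
Proof.
move=> UL2 U'L2 dU t0.
set F := within _ _.
have FF : Filter F by exact: within_filter.
pose e s := graph_norm L
  (graph_sub (graph_lin (s - t)^-1 (- (s - t)^-1) (U s) (U t)) (U' t)).
have e0 : e s @[s --> F] --> (0 : R) by exact: dU.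
have d0 : `|s - t| @[s --> F] --> (0 : R).
  have : `|s - t| @[s --> t] --> `|t - t|.
    by apply: cvg_norm; apply: cvgB; [exact: cvg_id|exact: cvg_cst].
  rewrite subrr normr0; apply: cvg_trans; apply: cvg_app.
  by move=> A /= [r r0 rA]; exists r => // s sr _ _; exact: rA.
pose w := graph_norm L (U t); pose p := graph_norm L (U' t).
have B0 : 2 * (e s * w) + `|s - t| * ((e s + p) * (e s + p)) @[s --> F] --> (0 : R).
  have -> : (0 : R) = 2 * (0 * w) + 0 * ((0 + p) * (0 + p)) by rewrite !mul0r mulr0 addr0.
  apply: cvgD.
    by apply: cvgMr; exact: cvgMl.
  apply: cvgM => //; apply: cvgM; apply: cvgD => //; exact: cvg_cst.
apply/cvgrPdist_le => /= eps eps0.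
have HB : \forall s \near F, 2 * (e s * w) + `|s - t| * ((e s + p) * (e s + p)) <= eps.
  move/cvgrPdist_le : B0 => /(_ _ eps0); apply: filterS => s.
  by rewrite sub0r normrN; apply: le_trans; exact: ler_norm.
have HF : \forall s \near F, 0 <= s /\ s != t.
  by exists 1 => //= s _ st; rewrite in_itv/= andbT => s0.
apply: filterS2 HF HB => s [s0 st] /(le_trans _); apply.
by apply: graph_inner_quotient_le; [exact: UL2|exact: UL2|exact: U'L2|rewrite subr_eq0|].
Qed.

Lemma graph_inner_derivative L U (U' : R -> graph_fun R) t :
  (forall s, 0 <= s -> graph_L2 L (U s)) -> (forall s, 0 <= s -> graph_L2 L (U' s)) ->
  L2_derivative L U U' -> 0 < t ->
  is_derive t (1 : R) (fun s => graph_inner L (U s) (U s)) (2 * graph_inner L (U' t) (U t)).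
Proof.
move=> UL2 U'L2 dU t0.
set N := fun s => _; set l := 2 * _.
suff H : (fun h : R => h^-1 *: ((N \o shift t) (h *: 1) - N t)) @ 0^' --> l.
  by apply: DeriveDef; [apply/cvg_ex; exists l|exact: cvg_lim].
have := L2_derivative_quotient_cvg UL2 U'L2 dU (ltW t0).
move=> /cvgrPdist_le /= Q; apply/cvgrPdist_le => /= eps eps0.
have [r /= r0 rQ] := Q _ eps0.
near=> h.
have h0 : h != 0 by near: h; exact: nbhs_dnbhs_neq.
have hr : `|h| < r by near: h; exact: dnbhs0_lt.
(* For t > 0 this keeps t + h in [0, +oo[, so the one-sided limit of the quotients becomes a
   two-sided derivative. *)
have ht : `|h| <= t by near: h; exact: dnbhs0_le.
have := rQ (h + t); rewrite /ball_/= opprD addrCA subrr addr0 normrN hr => /(_ isT).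
rewrite -[X in _ != X]add0r (inj_eq (addIr t)) h0 addrK => /(_ isT).
rewrite in_itv/= andbT -lerBlDr sub0r lerNl => /(_ (le_trans (ler_norm _) _)).
rewrite normrN => /(_ ht).
by rewrite /GRing.scale/= mulr1.
Unshelve. all: by end_near. Qed.

(** Needed at t = 0. The norm of D(A) dominates that of L^2(G), and |V|^2 - |W|^2 = |V - W|^2 + 2 <V
    - W, W> is controlled by Cauchy-Schwarz. *)
Lemma graph_inner_continuous L alpha beta U t :
  (forall s, 0 <= s -> graph_L2 L (U s)) -> continuous_in (A_norm L alpha beta) U -> 0 <= t ->
  graph_inner L (U s) (U s) @[s --> within `[0, +oo[%classic (nbhs t)] -->
    graph_inner L (U t) (U t).
Proof.
move=> UL2 cU t0; have := cU t t0; set F := within _ _ => dA.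
have FF : Filter F by exact: within_filter.
pose d s := graph_norm L (graph_sub (U s) (U t)).
pose w := graph_norm L (U t).
have F0 : \forall s \near F, 0 <= s.
  by exists 1 => //= s _; rewrite in_itv/= andbT.
have d0 : d s @[s --> F] --> (0 : R).
  apply: squeeze_cvgr (cvg_cst (0 : R)) dA.
  by apply: filterE => s; rewrite graph_norm_ge0/= lerDl graph_norm_ge0.
have B0 : d s * d s + 2 * (d s * w) @[s --> F] --> (0 : R).
  have -> : (0 : R) = 0 * 0 + 2 * (0 * w) by rewrite !mul0r mulr0 addr0.
  by apply: cvgD; [exact: cvgM|apply: cvgMr; exact: cvgMl].
apply/cvgrPdist_le => /= eps eps0.
move/cvgrPdist_le : B0 => /(_ _ eps0); apply: filterS2 F0 => s s0.
rewrite sub0r normrN => /(le_trans (ler_norm _)); apply: le_trans.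
have D2 : graph_L2 L (graph_sub (U s) (U t)) by apply: graph_L2_lin; exact: UL2.
have CS := graph_inner_CS D2 (UL2 t t0).
have -> : graph_inner L (U t) (U t) - graph_inner L (U s) (U s) =
   - (graph_inner L (graph_sub (U s) (U t)) (graph_sub (U s) (U t)) +
      2 * graph_inner L (graph_sub (U s) (U t)) (U t)).
  have Us := UL2 s s0; have Ut := UL2 t t0.
  have EX X : graph_L2 L X -> graph_inner L (graph_sub (U s) (U t)) X =
     graph_inner L (U s) X - graph_inner L (U t) X.
    by move=> X2; rewrite /graph_sub graph_inner_lin// mul1r mulN1r.
  rewrite (EX _ D2) (EX _ Ut) ![graph_inner L _ (graph_sub _ _)]graph_innerC.
  by rewrite (EX _ Us) (EX _ Ut) (graph_innerC L (U t) (U s)); ring.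
rewrite normrN; apply: le_trans (ler_normD _ _) _; rewrite lerD//.
  by rewrite -(graph_norm_sqr D2) expr2 ger0_norm// mulr_ge0 ?graph_norm_ge0.
by rewrite normrM ger0_norm// ler_wpM2l.
Qed.

Lemma classical_solution_decay L alpha beta gamma V U (T : R) : 0 < L ->
  classical_solution L alpha beta gamma V U -> 0 <= T ->
  graph_inner L (U T) (U T) <= expR (- (2 * gamma * T)) * graph_inner L (U 0) (U 0).
Proof.
move=> L0 [dA cU [U' [U'L2 dU _ eqU]] _].
have UL2 s : 0 <= s -> graph_L2 L (U s) by move=> /dA/A_dom_graph_L2.
pose N s := graph_inner L (U s) (U s).
have dN (s : R) : 0 < s -> is_derive s (1 : R) N (- (2 * gamma * N s)).
  move=> s0; have s0' := ltW s0.
  have AU2 := A_op_graph_L2 alpha beta L0 (dA s s0').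
  have W2 : graph_L2 L (graph_lin 1 (- gamma) (A_op L alpha beta (U s)) (U s)).
    by apply: graph_L2_lin => //; exact: UL2.
  have := graph_inner_derivative UL2 U'L2 dU s0.
  rewrite (graph_inner_eq (U'L2 s s0') W2 (UL2 s s0') (eqU s s0)).
  rewrite (graph_inner_lin _ _ AU2 (UL2 s s0') (UL2 s s0')) A_op_skew//; last exact: dA.
  by rewrite mulr0 add0r mulNr mulrN mulrA.
have [->|T0] := eqVneq T 0; first by rewrite mulr0 oppr0 expR0 mul1r.
rewrite le_eqVlt eq_sym (negbTE T0)/= => {}T0.
(* The integrating factor: its derivative 2 gamma compensates that of N, so that g has derivative 0
   on ]0, +oo[. *)
pose g s := expR (2 * gamma * s) * N s.
have dg (s : R) : 0 < s -> is_derive s (1 : R) g 0.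
  move=> s0; have dNs := dN s s0.
  have de : is_derive s (1 : R) (fun s => expR (2 * gamma * s))
      (expR (2 * gamma * s) * (2 * gamma)).
    apply: (@is_derive1_comp R expR (fun s => 2 * gamma * s)).
    by apply: is_derive_eq; rewrite /GRing.scale/= mulr1.
  have := is_deriveM de dNs; rewrite /GRing.scale/=.
  by congr (is_derive _ _ _ _); ring.
have : g T <= g 0.
  have I0 : 0 \in `[0, T] by rewrite in_itv/= lexx ltW.
  have IT : T \in `[0, T] by rewrite in_itv/= lexx ltW.
  apply: (@ler0_derive1_le_cc R g 0 T _ _ _ _ _ IT I0 (ltW T0)).
  - by move=> s; rewrite in_itv/= => /andP[s0 _]; have := dg s s0 => d; exact: ex_derive.
  - by move=> s; rewrite in_itv/= => /andP[s0 _]; have := dg s s0 => d; rewrite derive1E derive_val.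
  - apply/subspace_continuousP => s /=; rewrite in_itv/= => /andP[s0 sT].
    have NI : N x @[x --> within `[0, T]%classic (nbhs s)] --> N s.
      have := graph_inner_continuous UL2 cU s0; apply: cvg_trans; apply: cvg_app.
      move=> A /= [r r0 rA]; exists r => // x sr /=; rewrite in_itv/= => /andP[x0 _].
      by apply: rA => //=; rewrite in_itv/= x0.
    have FF : Filter (within `[0, T]%classic (nbhs s)) by exact: within_filter.
    have eI : expR (2 * gamma * x) @[x --> within `[0, T]%classic (nbhs s)] -->
        expR (2 * gamma * s).
      apply: cvg_within_filter.
      apply: (@continuous_comp _ _ _ (fun x => 2 * gamma * x) expR); last exact: continuous_expR.
      by apply: cvgMr; exact: cvg_id.
    by apply: cvgM; [exact: eI|exact: NI].
rewrite /g mulr0 expR0 mul1r => gT.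
by rewrite expRN ler_pdivlMl ?expR_gt0.
Qed.

Lemma graph_eq_norm L V W : graph_L2 L V -> graph_L2 L W -> graph_eq L V W ->
  graph_norm L V = graph_norm L W.
Proof.
move=> V2 W2 VW; rewrite !graph_normE// (graph_inner_eq V2 W2 V2 VW).
by rewrite graph_innerC (graph_inner_eq V2 W2 W2 VW).
Qed.

Lemma cvg_expR_decay (c : R) : 0 < c -> expR (- (c * t)) @[t --> +oo] --> (0 : R).
Proof.
move=> c0; apply: (@cvg_comp _ _ _ (fun t => c * t) (fun x => expR (- x)) _ _ _ _ (@cvgr_expR R)).
apply/cvgryPge => A; near=> t.
rewrite mulrC -ler_pdivrMr//; near: t; exact: nbhs_pinfty_ge.
Unshelve. all: by end_near. Qed.

End EnergyDecay.

Theorem theorem4p11 (R : realType) (L alpha beta gamma : R)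
    (U0 : graph_fun R) (U : R -> graph_fun R) :
  0 < L -> 0 < alpha -> 0 < gamma ->
  A_dom L U0 ->
  classical_solution L alpha beta gamma U0 U ->
  [/\ forall t, 0 <= t ->
        energy L (U t) <= expR (- (2 * gamma * t)) * energy L (U 0),
      forall t, 0 <= t ->
        graph_norm L (U t) <= expR (- (gamma * t)) * graph_norm L U0 &
      graph_norm L (U t) @[t --> +oo] --> (0 : R)].

Proof.
move=> L0 _ gamma0 dU0 sol.
have [dA _ _ eq0] := sol.
have UL2 t : 0 <= t -> graph_L2 L (U t) by move=> /dA/A_dom_graph_L2.
have n0 : graph_norm L (U 0) = graph_norm L U0.
  by apply: graph_eq_norm eq0; [exact: UL2|exact: A_dom_graph_L2].
have decay t : 0 <= t ->
    graph_norm L (U t) ^+ 2 <= expR (- (2 * gamma * t)) * graph_norm L (U 0) ^+ 2.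
  move=> t0; rewrite !graph_norm_sqr; [|exact: UL2|exact: UL2].
  exact: classical_solution_decay L0 sol t0.
have norm_decay t : 0 <= t -> graph_norm L (U t) <= expR (- (gamma * t)) * graph_norm L U0.
  (* Both sides are nonnegative, so their squares may be compared; squaring exp(-gamma t) gives the
     rate 2 gamma of the energy. *)
  move=> t0; rewrite -n0 -(@ler_pXn2r _ 2)// ?nnegrE ?mulr_ge0 ?expR_ge0 ?graph_norm_ge0//.
  rewrite exprMn -expRM_natl; apply: le_trans (decay t t0) _.
  by rewrite (_ : 2 * - (gamma * t) = - (2 * gamma * t)) ?lexx//; ring.
split=> //.
- by move=> t t0; rewrite /energy [leRHS]mulrCA ler_wpM2l ?invr_ge0//; exact: decay.
- have B0 : expR (- (gamma * t)) * graph_norm L U0 @[t --> +oo] --> (0 : R).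
    by rewrite -[X in _ --> X](mul0r (graph_norm L U0)); apply: cvgMl; exact: cvg_expR_decay.
  apply: squeeze_cvgr (cvg_cst (0 : R)) B0.
  near=> t; have t0 : 0 <= t by near: t; exact: nbhs_pinfty_ge.
  by rewrite graph_norm_ge0 norm_decay.
Unshelve. all: by end_near. Qed.
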